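(* Let $T\ge 1$, let $\Sigma_u,\Sigma_x$ be symmetric positive definite $T\times T$ matrices, and let $\mathcal{U}$ be a Gaussian process on $\mathbb{R}^T\times\mathbb{R}^T$ with covariance $$k_u([x,y],[v,w])=\sigma_u^2\exp\left(-\tfrac12 (x-v)^\intercal\Sigma_u^{-1}(x-v)-\tfrac12 (y-w)^\intercal\Sigma_u^{-1}(y-w)\right),\qquad \sigma_u>0.$$ Let $\mathcal{F}(x,y)=\mathcal{U}(x,y)-\mathcal{U}(y,x)$ with $\mathbb{E}[\mathcal{F}(x,y)]=0$ for all $x,y$. Let the attributes be i.i.d. multivariate Gaussian with covariance $\Sigma_x$, drawn independently of $\mathcal{F}$. Let $R$ be any matrix similar to $\Sigma_u^{-1}\Sigma_x$ and let $r_j=\sqrt{\lambda_j(R)}$, $j=1,\dots,T$. Then, as $r=(r_1,\dots,r_T)\to0$, the shared-endpoint correlation $\rho$ satisfies $$\frac12-\rho=\frac14\left(\mathrm{tr}(R)-\frac{\mathrm{tr}(R^2)}{\mathrm{tr}(R)}\right)+\mathcal{O}(\|r\|^4)=\frac14\left((T-1)\,\mathrm{av}(r^2)-\mathrm{dis}(r^2)\right)+\mathcal{O}(\|r\|^4).$$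
   Context: Let $X,Y,W$ be i.i.d. draws from the attribute distribution $\pi_X$, independent of the random skew-symmetric function $\mathcal{F}$. The variance and the shared-endpoint correlation are $$\sigma^2=\mathbb{E}_{\mathcal{F}}\left[\mathrm{Var}_{X,Y}(\mathcal{F}(X,Y)\mid\mathcal{F})\right],\qquad \rho=\frac{1}{\sigma^2}\,\mathbb{E}_{\mathcal{F}}\left[\mathrm{Cov}_{X,Y,W}(\mathcal{F}(X,Y),\mathcal{F}(X,W)\mid\mathcal{F})\right].$$ Here $\rho$ depends only on $r_1,\dots,r_T$. The notation is $\mathrm{av}(r^2)=\frac1T\sum_{j}r_j^2$ (arithmetic average) and $\mathrm{dis}(r^2)=\mathrm{var}(r^2)/\mathrm{av}(r^2)$ (index of dispersion), with $\mathrm{var}(r^2)=\frac1T\sum_j r_j^4-\mathrm{av}(r^2)^2$. *)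

(* Defs.v *)
From HB Require Import structures.
From mathcomp Require Import all_boot all_order all_algebra.
From mathcomp Require Import all_classical all_reals all_analysis.
Set Implicit Arguments.
Unset Strict Implicit.
Unset Printing Implicit Defensive.
Import Order.TTheory GRing.Theory Num.Theory.
Import numFieldNormedType.Exports.
Local Open Scope classical_set_scope.
Local Open Scope ring_scope.

(* The attribute space R^T is the type T.-tuple R, which carries the product
   Borel sigma-algebra; vec turns a point of it into a column vector. *)
Definition vec (R : realType) (T : nat) (x : T.-tuple R) : 'cV[R]_T :=
  \col_j tnth x j.

Definition posdefmx (R : realType) (T : nat) (A : 'M[R]_T) : Prop :=
  A^T = A /\
  forall x : 'cV[R]_T, x != 0 -> 0 < (x^T *m A *m x) ord0 ord0.

(* lam lists the eigenvalues of A, with algebraic multiplicity *)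
Definition eigenvalues_of (R : realType) (T : nat) (A : 'M[R]_T)
    (lam : 'I_T -> R) : Prop :=
  char_poly A = \prod_(j < T) ('X - (lam j)%:P).

(* Univariate normal law with mean m and standard deviation s. The case s = 0
   is the Dirac mass at m; it is treated apart because normal_prob m 0 is, by
   convention, the uniform law on [0, 1]. *)
Definition gaussian_rv d (Omega : measurableType d) (R : realType)
    (P : probability Omega R) (Z : Omega -> R) : Prop :=
  measurable_fun [set: Omega] Z /\
  exists m s : R, 0 <= s /\
    forall A : set R, measurable A ->
      P (Z @^-1` A) = if s == 0 then \d_m A else normal_prob m s A.

(* Every finite linear combination is a (possibly degenerate) normal variable.
   For a finite index type I this says that (Z i)_i is a Gaussian vector. *)
Definition gaussian_process d (Omega : measurableType d) (R : realType)
    (P : probability Omega R) (I : Type) (Z : I -> Omega -> R) : Prop :=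
  forall (n : nat) (t : 'I_n -> I) (a : 'I_n -> R),
    gaussian_rv P (fun w => \sum_(i < n) a i * Z (t i) w).

Definition multivariate_gaussian (R : realType) (T : nat)
    (mu : probability (T.-tuple R) R) (Sigma : 'M[R]_T) : Prop :=
  gaussian_process mu (fun (i : 'I_T) (x : T.-tuple R) => tnth x i) /\
  forall i j : 'I_T,
    covariance mu (fun x : T.-tuple R => tnth x i)
                  (fun x : T.-tuple R => tnth x j) = (Sigma i j)%:E.

Definition se_kernel (R : realType) (T : nat) (sigma_u : R)
    (Sigma_u : 'M[R]_T) (p q : T.-tuple R * T.-tuple R) : R :=
  let dx := vec p.1 - vec q.1 in
  let dy := vec p.2 - vec q.2 in
  sigma_u ^+ 2 *
  expR (- 2^-1 * (dx^T *m invmx Sigma_u *m dx) ord0 ord0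
        - 2^-1 * (dy^T *m invmx Sigma_u *m dy) ord0 ord0).

Definition skew_diff (R : realType) (Omega E : Type)
    (U : E * E -> Omega -> R) (w : Omega) (x y : E) : R :=
  U (x, y) w - U (y, x) w.

Definition iid3 d (Omega : measurableType d) (R : realType)
    (Q : probability Omega R) d' (E : measurableType d')
    (mu : probability E R) (X Y W : {RV Q >-> E}) : Prop :=
  (forall A : set E, measurable A ->
    [/\ distribution Q X A = mu A, distribution Q Y A = mu A
      & distribution Q W A = mu A]) /\
  (forall A B C : set E, measurable A -> measurable B -> measurable C ->
    Q (X @^-1` A `&` Y @^-1` B `&` W @^-1` C) =
    (Q (X @^-1` A) * Q (Y @^-1` B) * Q (W @^-1` C))%E).

Section correlation.
Context d (Omega : measurableType d) d' (Omega' : measurableType d')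
  d'' (E : measurableType d'') (R : realType).
(* The random function F lives on (Omega, P) and the attributes on
   (Omega', Q): on the product space they are independent, and conditioning on
   F amounts to freezing w : Omega. *)
Variables (P : probability Omega R) (Q : probability Omega' R).
Variable F : Omega -> E -> E -> R.
Variables X Y W : {RV Q >-> E}.

Definition edge_variance : \bar R :=
  (\int[P]_w 'V_Q[(fun v : Omega' => F w (X v) (Y v))])%E.

Definition shared_endpoint_covariance : \bar R :=
  (\int[P]_w covariance Q (fun v : Omega' => F w (X v) (Y v))
                          (fun v : Omega' => F w (X v) (W v)))%E.

Definition shared_endpoint_correlation : R :=
  (fine edge_variance)^-1 * fine shared_endpoint_covariance.

End correlation.

Section averages.
Context (R : realType) (T : nat).

Definition av (a : 'rV[R]_T) : R := T%:R^-1 * \sum_(j < T) a ord0 j.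

Definition sq (a : 'rV[R]_T) : 'rV[R]_T := \row_j (a ord0 j) ^+ 2.

Definition var (a : 'rV[R]_T) : R := av (sq a) - av a ^+ 2.

Definition dis (a : 'rV[R]_T) : R := var a / av a.

(* Euclidean norm; the library norm on 'rV[R]_T is the sup norm *)
Definition norm2 (a : 'rV[R]_T) : R := Num.sqrt (\sum_(j < T) (a ord0 j) ^+ 2).

End averages.

(* Main.v *)
Require Import Defs.
From HB Require Import structures.
From mathcomp Require Import all_boot all_order all_algebra.
From mathcomp Require Import all_classical all_reals all_analysis.
From mathcomp Require Import measurable_realfun ring lra.
Set Implicit Arguments.
Unset Strict Implicit.
Unset Printing Implicit Defensive.
Import Order.TTheory GRing.Theory Num.Theory.
Import numFieldNormedType.Exports.
Local Open Scope classical_set_scope.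
Local Open Scope ring_scope.

(* Write q(x, y) = (x - y)^T Sigma_u^-1 (x - y). For fixed attributes the
   covariance of F is explicit, so exchanging the averages over F and over the
   attributes gives rho = (B - C) / (1 - A) with
     A = E exp (- q(X, Y)),  B = E exp (- q(Y, W) / 2),
     C = E exp (- (q(X, W) + q(X, Y)) / 2).
   Up to an error of order E q^3 each exponential is its second-order Taylor
   polynomial. Factoring Sigma_u^-1 = L^T L turns q into a sum of squares of
   differences of centered Gaussian variables with covariance
   S = L Sigma_x L^T, so that the first two moments of q only depend on
   tr S = tr R and tr S^2 = tr R^2 (fourth moments come from the univariate ones
   by polarization), while E q^3 = O((tr R)^3). Dividing the two expansions
   gives the statement, since tr R = ||r||^2. *)

(** * Expectations of integrable functions *)

(** Put t = tr R. Up to the factor 2 sigma_u^2, which the variance and the covariance share, the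
    variance is 1 - A and is itself of order t. Dividing by it costs one power of t, so numerator
    and denominator must be known up to O(t^3) to leave an error O(t^2) = O(||r||^4); this fixes the
    order of the Taylor expansion. The cubic remainder enters only through an upper bound whose
    constant depends on T alone, which makes the final estimate uniform over all models. For a fixed
    sample of F, skew symmetry centers F(X, Y), so conditional variance and covariance are plain
    second moments. An integral has a value even when the integrand is not integrable, and linearity
    requires integrability; hence [hasE] carries both facts through every computation. *)

Definition hasE d (X : measurableType d) (R : realType)
    (mu : {measure set X -> \bar R}) (f : X -> R) (e : R) : Prop :=
  mu.-integrable [set: X] (EFin \o f) /\ (\int[mu]_x (f x)%:E = e%:E)%E.

Section has_expectation.
Context d (X : measurableType d) (R : realType) (mu : {measure set X -> \bar R}).
Implicit Types (f g : X -> R) (a b e : R).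

Lemma hasE_measurable f e : hasE mu f e -> measurable_fun [set: X] f.
Proof. by move=> [/measurable_int/measurable_EFinP]. Qed.

(** The two equations, on integrands and on values, leave only algebraic identities to [ring] or
    [field] after a computation with [hasED], [hasEZ] and [hasEB]. *)
Lemma hasE_eq f g a b : hasE mu f a -> f =1 g -> a = b -> hasE mu g b.
Proof. by move=> h /funext <- <-. Qed.

Lemma hasE_unique f a b : hasE mu f a -> hasE mu f b -> a = b.
Proof. by move=> [_ ha] [_]; rewrite ha => -[]. Qed.

Lemma hasED f g a b : hasE mu f a -> hasE mu g b ->
  hasE mu (fun x => f x + g x) (a + b).
Proof.
move=> [fi fa] [gi gb]; split; first exact: (integrableD measurableT fi gi).
by under eq_integral do rewrite EFinD; rewrite integralD//= fa gb.
Qed.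

Lemma hasEZ k f a : hasE mu f a -> hasE mu (fun x => k * f x) (k * a).
Proof.
move=> [fi fa]; split; first exact: (integrableZl measurableT k fi).
by under eq_integral do rewrite EFinM; rewrite integralZl//= fa.
Qed.

Lemma hasEB f g a b : hasE mu f a -> hasE mu g b ->
  hasE mu (fun x => f x - g x) (a - b).
Proof.
move=> fa /(hasEZ (-1)) gb; apply: hasE_eq (hasED fa gb) _ _ => [x|]; ring.
Qed.

Lemma hasE0 : hasE mu (fun=> 0) 0.
Proof. by split; [exact: integrable0|rewrite integral0]. Qed.

Lemma hasE_sum (I : Type) (s : seq I) (F : I -> X -> R) (e : I -> R) :
  (forall i, hasE mu (F i) (e i)) ->
  hasE mu (fun x => \sum_(i <- s) F i x) (\sum_(i <- s) e i).
Proof.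
move=> Fe; elim: s => [|i s ih].
  by apply: hasE_eq hasE0 _ _ => [x|]; rewrite big_nil.
by apply: hasE_eq (hasED (Fe i) ih) _ _ => [x|]; rewrite big_cons.
Qed.

Lemma hasE_le f g a b : hasE mu f a -> hasE mu g b -> (forall x, f x <= g x) ->
  a <= b.
Proof.
move=> [fi fa] [gi gb] fg; rewrite -lee_fin -fa -gb.
by apply: le_integral => // x _; rewrite lee_fin.
Qed.

Lemma hasE_ge0 f e : measurable_fun [set: X] f -> (forall x, 0 <= f x) ->
  (\int[mu]_x (f x)%:E = e%:E)%E -> hasE mu f e.
Proof.
move=> mf f0 fe; split => //; apply/integrableP; split.
  exact/measurable_EFinP.
under eq_integral do rewrite /= ger0_norm//.
by rewrite fe ltry.
Qed.

Lemma hasE_dominated f g e : measurable_fun [set: X] f -> hasE mu g e ->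
  (forall x, `|f x| <= g x) -> exists e', hasE mu f e'.
Proof.
move=> mf [gi _] fg.
have fi : mu.-integrable [set: X] (EFin \o f).
  apply: (le_integrable measurableT _ _ gi); first exact/measurable_EFinP.
  by move=> x _ /=; rewrite lee_fin (le_trans (fg x))// ler_norm.
exists (fine (\int[mu]_x (f x)%:E)%E); split => //; rewrite fineK//.
exact: integrable_fin_num.
Qed.

End has_expectation.

Lemma hasE_cst d (X : measurableType d) (R : realType) (P : probability X R)
  (c : R) : hasE P (fun=> c) c.
Proof.
split; first exact: finite_measure_integrable_cst.
by rewrite integral_cst//= probability_setT mule1.
Qed.

Lemma hasE_bounded d (X : measurableType d) (R : realType) (P : probability X R)
  (f : X -> R) (c : R) : measurable_fun [set: X] f ->
  (forall x, `|f x| <= c) -> exists e, hasE P f e.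
Proof. by move=> mf; apply: hasE_dominated (hasE_cst P c). Qed.

(** * Moments of Gaussian variables *)

Section gauss_moments.
Variable R : realType.
Local Notation mu := (@lebesgue_measure R).
Local Notation gauss := (@gauss_fun R).

Lemma is_derive_gauss (x : R) : is_derive x 1 gauss (- (2 * x) * gauss x).
Proof.
rewrite /gauss_fun -[X in is_derive _ _ X _]/(expR \o (fun y : R => - y ^+ 2)).
apply: is_derive_eq.
by rewrite /GRing.scale/=; ring.
Qed.

(** From (x - 1)^2 >= 0 comes exp (- x^2) <= e exp (- x)^2, and the exponential series gives x^k <=
    k! exp x; one factor exp (- x) cancels. *)
Lemma XnM_gauss_le (k : nat) (x : R) : 0 <= x ->
  x ^+ k * gauss x <= k`!%:R * expR 1 * expR (- x).
Proof.
move=> x0.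
have gx : gauss x <= expR 1 * expR (- x) * expR (- x).
  rewrite -!expRD ler_expR; have := sqr_ge0 (x - 1); rewrite sqrrB1; lra.
have xk : x ^+ k <= k`!%:R * expR x.
  case: k => [|k]; first by rewrite expr0 mul1r leNgt expR_lt1 -leNgt.
  have := expR_ge1Dxn k x0.
  rewrite -ler_pdivrMl ?ltr0n ?fact_gt0// mulrC; apply: le_trans.
  by rewrite lerDr.
apply: (le_trans (ler_pM _ _ xk gx)); rewrite ?exprn_ge0 ?gauss_fun_ge0//.
rewrite le_eqVlt; apply/orP; left; apply/eqP.
have := expRxMexpNx_1 x.
move: (expR x) (expR (- x)) => a b ab.
rewrite (_ : _ * (_ * _) = k`!%:R * expR 1 * b * (a * b)); last by ring.
by rewrite ab mulr1.
Qed.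

Lemma cvg_XnM_gauss (k : nat) : (fun x : R => x ^+ k * gauss x) @ +oo --> (0 : R).
Proof.
apply: (@squeeze_cvgr _ _ _ _ (cst 0) (fun x => k`!%:R * expR 1 * expR (- x))).
- near=> x; have x0 : 0 <= x by near: x; exact: nbhs_pinfty_ge.
  by rewrite /= mulr_ge0 ?exprn_ge0 ?gauss_fun_ge0//= XnM_gauss_le.
- exact: cvg_cst.
- rewrite -[X in _ --> X](mulr0 (k`!%:R * expR 1)).
  by apply: cvgM; [exact: cvg_cst|exact: cvgr_expR].
Unshelve. all: by end_near. Qed.

Lemma continuous_XnM_gauss (k : nat) : continuous (fun x : R => x ^+ k * gauss x).
Proof.
by move=> x; apply: cvgM; [exact: exprn_continuous|exact: continuous_gauss_fun].
Qed.

(* The summand [c expR (- x)], whose integral is known, makes the integrand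
   [f] nonnegative, as the fundamental theorem on [[0, +oo[] requires. *)
Lemma integral0y_XnM_gauss_rec (k : nat) :
  (\int[mu]_(x in `[0%R, +oo[) (x ^+ k.+2 * gauss x)%:E =
   (k.+1%:R / 2)%:E * \int[mu]_(x in `[0%R, +oo[) (x ^+ k * gauss x)%:E)%E.
Proof.
pose b : R := k.+1%:R / 2.
have b0 : 0 <= b by rewrite divr_ge0.
(* By [XnM_gauss_le] this makes [h] dominate [b * (x ^+ k * gauss x)], the negative term of [f]. *)
pose c : R := b * (k`!%:R * expR 1).
pose h (x : R) : R := c * expR (- x).
pose f (x : R) : R := x ^+ k.+2 * gauss x - b * (x ^+ k * gauss x) + h x.
have h0 x : 0 <= h x by rewrite !mulr_ge0 ?expR_ge0.
have cg i : continuous (fun x : R => x ^+ i * gauss x) by exact: continuous_XnM_gauss.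
have ch : continuous h.
  move=> x; apply: cvgM; first exact: cvg_cst.
  apply: (cvg_comp (fun y : R => - y) expR); last exact: continuous_expR.
  by apply: (@cvgN _ R^o); exact: cvg_id.
have f0 (x : R) : 0 <= x -> 0 <= f x.
  move=> x0; have := ler_wpM2l b0 (XnM_gauss_le k x0).
  have : 0 <= x ^+ k.+2 * gauss x by rewrite mulr_ge0 ?exprn_ge0 ?gauss_fun_ge0.
  rewrite /f /h /c -!mulrA; lra.
have cf : continuous f.
  move=> x; apply: cvgD; last exact: ch.
  apply: cvgB; first exact: cg.
  by apply: cvgM; [exact: cvg_cst|exact: cg].
have If : (\int[mu]_(x in `[0%R, +oo[) (f x)%:E = c%:E)%E.
  (* Antiderivative from integration by parts; it tends to 0 at infinity and equals [- c] at 0,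
     because the power [k.+1] is positive. *)
  pose F (x : R) : R := - 2^-1 * (x ^+ k.+1 * gauss x) - h x.
  have dF (x : R) : is_derive x 1 F (f x).
    have := is_derive_gauss x => ?.
    have -> : F = (- 2^-1 : R) \*: ((id ^+ k.+1) * gauss : R -> R) -
        c \*: ((expR \o -%R) : R -> R).
      by apply/funext => y; rewrite !fctE.
    apply: is_derive_eq.
    rewrite /f /h /b /GRing.scale/= exprfctE mulr1 !exprS.
    by move: (gauss x) (expR (- x)) (x ^+ k) (k.+1%:R : R) => g e y n; field.
  rewrite (@ge0_continuous_FTC2y _ f F 0 0)//.
  - by rewrite /F /h expr0n oppr0 expR0 -EFinB; congr EFin; rewrite /=; ring.
  - exact: continuous_subspaceT.
  - rewrite /F -[X in _ --> X](_ : - 2^-1 * 0 - c * 0 = 0); last by rewrite !mulr0 subr0.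
    apply: cvgB; apply: cvgM; try exact: cvg_cst.
      exact: cvg_XnM_gauss.
    exact: cvgr_expR.
  - apply: cvg_at_right_filter; apply: differentiable_continuous.
    exact/derivable1_diffP.
  - by move=> x _; rewrite derive1E; apply: derive_val.
have Ih : (\int[mu]_(x in `[0%R, +oo[) (h x)%:E = c%:E)%E.
  pose F (x : R) : R := - h x.
  have dF (x : R) : is_derive x 1 F (h x).
    have -> : F = - (c \*: ((expR \o -%R) : R -> R)) by [].
    apply: is_derive_eq.
    rewrite /h /GRing.scale/=; ring.
  rewrite (@ge0_continuous_FTC2y _ h F 0 0)//.
  - by rewrite /F /h oppr0 expR0 -EFinB; congr EFin; ring.
  - exact: continuous_subspaceT.
  - rewrite /F /h -[X in _ --> X](_ : - (c * 0) = 0); last by rewrite !mulr0 oppr0.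
    by apply: cvgN; apply: cvgM; [exact: cvg_cst|exact: cvgr_expR].
  - apply: cvg_at_right_filter; apply: differentiable_continuous.
    exact/derivable1_diffP.
  - by move=> x _; rewrite derive1E; apply: derive_val.
have mc (g : R -> R) : continuous g ->
    measurable_fun (`[0%R, +oo[ : set R) (fun x => (g x)%:E).
  move=> cg'; apply/measurable_EFinP/measurable_funTS.
  exact: continuous_measurable_fun.
have xg0 i (x : R) : x \in `[0%R, +oo[ -> 0 <= x ^+ i * gauss x.
  by rewrite in_itv/= andbT => x0; rewrite mulr_ge0 ?exprn_ge0 ?gauss_fun_ge0.
(* Adding the finite number [c], the integral of both [f] and [h], turns the claim into an identity
   between integrals of nonnegative functions. *)
suff : (\int[mu]_(x in `[0%R, +oo[) (x ^+ k.+2 * gauss x)%:E + c%:E =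
  b%:E * \int[mu]_(x in `[0%R, +oo[) (x ^+ k * gauss x)%:E + c%:E)%E.
  by move/(congr1 (fun z => z - c%:E)%E); rewrite !addeK.
rewrite -{1}Ih -If -ge0_integralZl//; last 2 first.
- exact: mc.
- by move=> x x0; rewrite lee_fin xg0.
rewrite -!ge0_integralD//=; first (by apply: eq_integral => x _;
    rewrite -!EFinM -!EFinD /f; congr EFin; ring).
- by move=> x x0; rewrite lee_fin mulr_ge0// xg0.
- by apply: mc => x; apply: cvgM; [exact: cvg_cst|exact: cg].
- by move=> x; rewrite /= in_itv/= andbT => x0; rewrite lee_fin f0.
- exact: mc.
- by move=> x x0; rewrite lee_fin xg0.
- exact: mc.
- by move=> x _; rewrite lee_fin.
- exact: mc.
Qed.

End gauss_moments.

(** * Integrals against the Gaussian weight and normal laws *)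

Section gauss_integrals.
Variable R : realType.
Local Notation mu := (@lebesgue_measure R).
Local Notation gauss := (@gauss_fun R).

(** Folding the negative half-line onto the positive one cancels odd terms pointwise, while only
    nonnegative functions are integrated. *)
Lemma ge0_integralT_half (f : R -> R) : (forall x, 0 <= f x) -> continuous f ->
  (\int[mu]_x (f x)%:E =
   \int[mu]_(x in `[0%R, +oo[) (f x + f (- x))%:E)%E.
Proof.
move=> f0 cf.
have mf : measurable_fun [set: R] f by exact: continuous_measurable_fun.
rewrite -(setUv (`[0%R, +oo[ : set R)) ge0_integral_setU//= ; last 4 first.
- exact: measurableC.
- by apply/measurable_EFinP; rewrite setUv.
- by move=> x _; rewrite lee_fin.
- exact/disj_setPCl.
rewrite setCitvr integral_itv_bndo_bndc; last exact/measurable_EFinP/measurable_funTS.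
rewrite -{2}oppr0 ge0_integration_by_substitutionNy//; last first.
  exact: continuous_subspaceT.
rewrite -ge0_integralD//=.
- by move=> x _; rewrite lee_fin.
- exact/measurable_EFinP/measurable_funTS.
- by move=> x _; rewrite lee_fin.
- by apply/measurable_EFinP/measurable_funTS; exact: measurableT_comp.
Qed.

Lemma integralT_even_gauss (k : nat) :
  (\int[mu]_x (x ^+ k.*2 * gauss x)%:E =
   2%:E * \int[mu]_(x in `[0%R, +oo[) (x ^+ k.*2 * gauss x)%:E)%E.
Proof.
have pos x : 0 <= x ^+ k.*2 * gauss x.
  by rewrite mulr_ge0 ?gauss_fun_ge0// exprn_even_ge0 ?odd_double.
have mg : measurable_fun [set: R] (fun x : R => x ^+ k.*2 * gauss x).
  by apply: continuous_measurable_fun; exact: continuous_XnM_gauss.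
rewrite ge0_integralT_half//; last exact: continuous_XnM_gauss.
rewrite -ge0_integralZl//=; last 2 first.
- exact/measurable_EFinP/measurable_funTS.
- by move=> x _; rewrite lee_fin.
apply: eq_integral => x _; rewrite -EFinM; congr EFin.
by rewrite /gauss_fun sqrrN exprNn -signr_odd odd_double expr0 mul1r; ring.
Qed.

Lemma hasE_even_gauss_rec (k : nat) (e : R) :
  hasE mu (fun x => x ^+ k.*2 * gauss x) e ->
  hasE mu (fun x => x ^+ k.+1.*2 * gauss x) (k.*2.+1%:R / 2 * e).
Proof.
move=> [_ he]; apply: hasE_ge0.
- by apply: continuous_measurable_fun; exact: continuous_XnM_gauss.
- by move=> x; rewrite mulr_ge0 ?gauss_fun_ge0// exprn_even_ge0 ?odd_double.
rewrite integralT_even_gauss doubleS integral0y_XnM_gauss_rec muleCA.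
by rewrite -integralT_even_gauss he.
Qed.

Lemma hasE_gauss : hasE mu gauss (Num.sqrt pi).
Proof. by split; [exact: integrableT_gauss|exact: integralT_gauss]. Qed.

Lemma hasE_gauss2 : hasE mu (fun x => x ^+ 2 * gauss x) (2^-1 * Num.sqrt pi).
Proof.
apply: hasE_eq (@hasE_even_gauss_rec 0 _ _) _ _ => //.
- by apply: hasE_eq hasE_gauss _ _ => [x|]; [rewrite expr0 mul1r|reflexivity].
- by rewrite mul1r.
Qed.

Lemma hasE_gauss4 : hasE mu (fun x => x ^+ 4 * gauss x) (3 / 4 * Num.sqrt pi).
Proof.
by apply: hasE_eq (@hasE_even_gauss_rec 1 _ hasE_gauss2) _ _ => //; rewrite -[1.*2.+1]/3%N; field.
Qed.

Lemma hasE_gauss6 : hasE mu (fun x => x ^+ 6 * gauss x) (15 / 8 * Num.sqrt pi).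
Proof.
by apply: hasE_eq (@hasE_even_gauss_rec 2 _ hasE_gauss4) _ _ => //; rewrite -[2.*2.+1]/5%N; field.
Qed.

Lemma one_add_sqr_add_ge0 (u : R) : 0 <= 1 + u ^+ 2 + u.
Proof. by have := sqr_ge0 (u + 1); have := sqr_ge0 u; rewrite sqrrD1; lra. Qed.

(** This yields first moments from nonnegative integrands: [1 + u ^+ 2 + u] is nonnegative, its odd
    term disappears when the line is folded, and the second moment is known. *)
Lemma hasE_gauss_shifted (s : R) :
  hasE mu (fun x => (1 + (s * x) ^+ 2 + s * x) * gauss x)
    ((1 + s ^+ 2 / 2) * Num.sqrt pi).
Proof.
have he : hasE mu (fun x => (1 + (s * x) ^+ 2) * gauss x)
    ((1 + s ^+ 2 / 2) * Num.sqrt pi).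
  apply: hasE_eq (hasED hasE_gauss (hasEZ (s ^+ 2) hasE_gauss2)) _ _ => [x|];
  ring.
have cp (p : {poly R}) : continuous (fun x => p.[x] * gauss x).
  move=> x; apply: cvgM; [exact: continuous_horner|exact: continuous_gauss_fun].
have c1 : continuous (fun x => (1 + (s * x) ^+ 2 + s * x) * gauss x).
  have := cp (1 + (s *: 'X) ^+ 2 + s *: 'X).
  by under eq_fun do rewrite !hornerE.
have c2 : continuous (fun x => (1 + (s * x) ^+ 2) * gauss x).
  have := cp (1 + (s *: 'X) ^+ 2).
  by under eq_fun do rewrite !hornerE.
apply: hasE_ge0.
- exact: continuous_measurable_fun.
- by move=> x; rewrite mulr_ge0 ?gauss_fun_ge0 ?one_add_sqr_add_ge0.
rewrite -he.2 !ge0_integralT_half//.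
- by apply: eq_integral => x _; congr EFin; rewrite /gauss_fun sqrrN; ring.
- by move=> x; rewrite mulr_ge0 ?gauss_fun_ge0 ?addr_ge0 ?sqr_ge0.
- by move=> x; rewrite mulr_ge0 ?gauss_fun_ge0 ?one_add_sqr_add_ge0.
Qed.

(** The change of variables is stated with the Radon-Nikodym derivative, which agrees with
    [normal_pdf] almost everywhere since both integrate to the normal measure on every measurable
    set. *)
Lemma ge0_integral_normal_prob (m s : R) (G : R -> R) :
  measurable_fun [set: R] G -> (forall x, 0 <= G x) ->
  (\int[normal_prob m s]_x (G x)%:E =
   \int[mu]_x (G x * normal_pdf m s x)%:E)%E.
Proof.
move=> mG G0.
have dom := normal_prob_dominates m s.
rewrite -(Radon_Nikodym_SigmaFinite.change_of_variables dom)//=; last exact/measurable_EFinP.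
have fint := Radon_Nikodym_SigmaFinite.f_integrable dom.
under [RHS]eq_integral do rewrite EFinM.
apply: ae_eq_integral => //.
- apply: emeasurable_funM; first exact/measurable_EFinP.
  exact: measurable_int fint.
- apply: emeasurable_funM; first exact/measurable_EFinP.
  apply/measurable_EFinP; exact: measurable_normal_pdf.
- apply: ae_eqe_mul2l => /=.
  apply: integral_ae_eq => //=.
  + by apply/measurable_EFinP; exact: measurable_normal_pdf.
  + by move=> E _ mE; rewrite -Radon_Nikodym_SigmaFinite.f_integral.
Qed.

(** Substitution y = (x - m) / (sqrt 2 s), which reduces every normal law to the weight exp (-
    y^2). *)
Lemma ge0_integral_normal_gauss (m s : R) (G : R -> R) :
  0 < s -> continuous G -> (forall x, 0 <= G x) ->
  (\int[normal_prob m s]_x (G x)%:E =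
   (Num.sqrt pi)^-1%:E *
   \int[mu]_y (G (m + Num.sqrt 2 * s * y) * gauss y)%:E)%E.
Proof.
move=> s0 cG G0.
rewrite ge0_integral_normal_prob//; last exact: continuous_measurable_fun.
set c := Num.sqrt 2 * s.
have c0 : 0 < c by rewrite mulr_gt0// sqrtr_gt0.
have pi0 : 0 < Num.sqrt pi :> R by rewrite sqrtr_gt0 pi_gt0.
pose F (x : R^o) : R^o := c^-1 * (x - m).
have FE : F^`()%classic = cst c^-1.
  apply/funext => x; rewrite derive1E.
  have -> : F = c^-1 \*: (id - cst m : R -> R) by apply/funext.
  by rewrite derive_val subr0 /GRing.scale/= mulr1.
have cH : continuous (fun y => G (m + c * y) * gauss y).
  move=> y; apply: cvgM; last exact: continuous_gauss_fun.
  apply: (cvg_comp (fun y => m + c * y) G); last exact: cG.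
  by apply: (@cvgD _ R^o); [exact: cvg_cst|apply: cvgM; [exact: cvg_cst|exact: cvg_id]].
rewrite (@increasing_ge0_integration_by_substitutionT _ F
  (fun y => G (m + c * y) * gauss y))//; first last.
- by move=> y; rewrite mulr_ge0 ?gauss_fun_ge0.
- by apply/gt0_cvgMry; [rewrite invr_gt0|exact: cvg_addrr].
- by apply/gt0_cvgMrNy; [rewrite invr_gt0|exact: cvg_addrr_Ny].
- by rewrite FE; exact: is_cvg_cst.
- by rewrite FE; exact: is_cvg_cst.
- by rewrite FE => ?; exact: cvg_cst.
- by move=> x y xy; rewrite /F ltr_pM2l ?invr_gt0// ltrD2r.
have mH : measurable_fun [set: R]
   (((fun y => G (m + c * y) * gauss y) \o F) * F^`()%classic).
  rewrite FE; apply: measurable_funM => //.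
  apply: measurableT_comp; first exact: continuous_measurable_fun.
  by apply: measurable_funM => //; exact: measurable_funB.
rewrite -ge0_integralZl//=; first last.
- move=> x _; rewrite FE lee_fin; apply: mulr_ge0; first exact: mulr_ge0 (gauss_fun_ge0 _).
  by rewrite invr_ge0 ltW.
- exact/measurable_EFinP.
apply: eq_integral => x _; rewrite -EFinM; congr EFin; rewrite FE /= !fctE/=.
rewrite normal_pdfE ?gt_eqF// /F mulVKf ?gt_eqF// subrKC.
have -> : normal_peak s = (Num.sqrt pi)^-1 * c^-1.
  rewrite /normal_peak -invfM; congr (_^-1).
  rewrite /c -mulr_natr -mulrA sqrtrM ?sqr_ge0// sqrtr_sqr gtr0_norm//.
  by rewrite sqrtrM ?pi_ge0//; ring.
have -> : normal_fun m s x = gauss (c^-1 * (x - m)).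
  rewrite /normal_fun /gauss_fun; congr expR.
  rewrite exprMn exprVn /c exprMn sqr_sqrtr//; field.
  by rewrite gt_eqF.
ring.
Qed.

End gauss_integrals.

(** * Integrals transported along a map with a given law *)

Section law.
Context d1 d2 (X : measurableType d1) (Y : measurableType d2) (R : realType).
Variables (mu : {measure set X -> \bar R}) (nu : {measure set Y -> \bar R}).
Variable phi : X -> Y.
Hypothesis mphi : measurable_fun [set: X] phi.
Hypothesis law : forall A, measurable A -> mu (phi @^-1` A) = nu A.

Lemma ge0_integral_law (f : Y -> \bar R) :
  measurable_fun [set: Y] f -> (forall y, 0 <= f y)%E ->
  (\int[mu]_x f (phi x) = \int[nu]_y f y)%E.
Proof.
move=> mf f0.
pose mphi_mixin := isMeasurableFun.Build _ _ _ _ _ mphi.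
pose mphi_pack : {mfun _ >-> _} := HB.pack phi mphi_mixin.
have := @ge0_integral_pushforward _ _ _ _ _ _ mphi mu setT _ measurableT mf
  (fun y _ => f0 y).
rewrite preimage_setT => <-.
apply: (@eq_measure_integral _ _ _ _ nu (pushforward mu mphi_pack)) => A mA _.
exact: law.
Qed.

Lemma hasE_law (f : Y -> R) (e : R) :
  hasE nu f e -> hasE mu (fun x => f (phi x)) e.
Proof.
move=> fe; have mf := hasE_measurable fe.
have [/integrableP[_ fi] fE] := fe.
pose mphi_mixin := isMeasurableFun.Build _ _ _ _ _ mphi.
pose mphi_pack : {mfun _ >-> _} := HB.pack phi mphi_mixin.
have fphi : mu.-integrable [set: X] ((EFin \o f) \o phi).
  apply/integrableP; split.
    by apply/measurable_EFinP; exact: measurableT_comp mf mphi.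
  rewrite (ge0_integral_law (f := abse \o (EFin \o f)))//; last by move=> y; exact: abse_ge0.
  by apply: measurableT_comp => //; exact/measurable_EFinP.
split => //; rewrite -fE.
have := @integral_pushforward _ _ _ _ _ _ mphi mu setT (EFin \o f).
rewrite preimage_setT => <-//; last exact/measurable_EFinP.
apply: (@eq_measure_integral _ _ _ _ nu (pushforward mu mphi_pack)) => A mA _.
exact: law.
Qed.

End law.

Section gaussian_rv_moments.
Context d (Omega : measurableType d) (R : realType) (P : probability Omega R).
Local Notation mu := (@lebesgue_measure R).
Local Notation gauss := (@gauss_fun R).

(** The formula also covers the Dirac case s = 0: the argument of [G] is then the constant m, and
    the weight has total mass sqrt pi. *)
Lemma ge0_integral_gaussian_rv (Z : Omega -> R) : gaussian_rv P Z ->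
  exists m s : R, forall G : R -> R, continuous G -> (forall x, 0 <= G x) ->
    (\int[P]_w (G (Z w))%:E =
     (Num.sqrt pi)^-1%:E * \int[mu]_y (G (m + Num.sqrt 2 * s * y) * gauss y)%:E)%E.
Proof.
move=> [mZ [m [s [s0 law]]]]; exists m, s => G cG G0.
have mG : measurable_fun [set: R] (EFin \o G).
  by apply/measurable_EFinP; exact: continuous_measurable_fun.
move: law s0; have [-> law _|s_neq0 law s_ge0] := eqVneq s 0; last first.
  rewrite -ge0_integral_normal_gauss ?lt_neqAle 1?eq_sym ?s_neq0//.
  exact: (ge0_integral_law mZ (nu := normal_prob m s) law (f := EFin \o G) mG).
rewrite (ge0_integral_law mZ (nu := dirac m) law (f := EFin \o G))//.
rewrite integral_dirac//= diracT mul1e.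
under eq_integral do rewrite mulr0 mul0r addr0 EFinM.
have [gi ge] := hasE_gauss R.
rewrite integralZl//= ge -!EFinM mulrCA mulVf ?mulr1//.
by rewrite gt_eqF// sqrtr_gt0 pi_gt0.
Qed.

Lemma gaussian_rv_moments (Z : Omega -> R) : gaussian_rv P Z ->
  exists m s : R,
    [/\ hasE P Z m, hasE P (fun w => (Z w - m) ^+ 2) (s ^+ 2),
        hasE P (fun w => (Z w - m) ^+ 4) (3 * s ^+ 4)
      & hasE P (fun w => (Z w - m) ^+ 6) (15 * s ^+ 6)].
Proof.
move=> gZ; have [m [s E]] := ge0_integral_gaussian_rv gZ; exists m, s.
have [mZ _] := gZ.
have pi0 : Num.sqrt pi != 0 :> R by rewrite gt_eqF// sqrtr_gt0 pi_gt0.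
have H (p : {poly R}) (c : R) : (forall x, 0 <= p.[x]) ->
    hasE mu (fun y => p.[Num.sqrt 2 * s * y] * gauss y) (c * Num.sqrt pi) ->
    hasE P (fun w => p.[Z w - m]) c.
  move=> p0 [_ he].
  have cp : continuous (fun x => p.[x - m]).
    move=> x; apply: (cvg_comp (fun x => x - m) (horner p)).
      by apply: (@cvgB _ R^o); [exact: cvg_id|exact: cvg_cst].
    exact: continuous_horner.
  apply: hasE_ge0 => //.
    exact: measurableT_comp (continuous_measurable_fun cp) mZ.
  rewrite (E (fun x => p.[x - m]))//.
  under eq_integral do rewrite addrC addKr.
  by rewrite he -EFinM mulrCA mulVf// mulr1.
have sq2 : Num.sqrt 2 ^+ 2 = 2 :> R by rewrite sqr_sqrtr.
have h2 : hasE P (fun w => (Z w - m) ^+ 2) (s ^+ 2).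
  apply: hasE_eq (H ('X ^+ 2) (s ^+ 2) _ _) _ erefl; last by move=> w; rewrite !hornerE.
    by move=> x; rewrite !hornerE sqr_ge0.
  apply: hasE_eq (hasEZ ((Num.sqrt 2 * s) ^+ 2) (hasE_gauss2 R)) _ _ => [x|].
    by rewrite hornerXn [in RHS]exprMn mulrA.
  by rewrite exprMn sq2; field.
have h4 : hasE P (fun w => (Z w - m) ^+ 4) (3 * s ^+ 4).
  apply: hasE_eq (H ('X ^+ 4) (3 * s ^+ 4) _ _) _ erefl; last by move=> w; rewrite !hornerE.
    by move=> x; rewrite !hornerE exprn_even_ge0.
  apply: hasE_eq (hasEZ ((Num.sqrt 2 * s) ^+ 4) (hasE_gauss4 R)) _ _ => [x|].
    by rewrite hornerXn [in RHS]exprMn mulrA.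
  by rewrite exprMn (exprM _ 2 2) sq2; field.
have h6 : hasE P (fun w => (Z w - m) ^+ 6) (15 * s ^+ 6).
  apply: hasE_eq (H ('X ^+ 6) (15 * s ^+ 6) _ _) _ erefl; last by move=> w; rewrite !hornerE.
    by move=> x; rewrite !hornerE exprn_even_ge0.
  apply: hasE_eq (hasEZ ((Num.sqrt 2 * s) ^+ 6) (hasE_gauss6 R)) _ _ => [x|].
    by rewrite hornerXn [in RHS]exprMn mulrA.
  by rewrite exprMn (exprM _ 2 3) sq2; field.
split => //.
(* Subtracting the second moment and the constant 1 - m from this nonnegative expression leaves the
   mean of [Z]. *)
have hs : hasE P (fun w => 1 + (Z w - m) ^+ 2 + (Z w - m)) (1 + s ^+ 2).
  apply: hasE_eq (H (1 + 'X ^+ 2 + 'X) (1 + s ^+ 2) _ _) _ erefl; last by move=> w; rewrite !hornerE.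
    by move=> x; rewrite !hornerE one_add_sqr_add_ge0.
  apply: hasE_eq (hasE_gauss_shifted (Num.sqrt 2 * s)) _ _ => [x|].
    by rewrite !hornerE.
  by rewrite exprMn sq2; field.
apply: hasE_eq (hasEB hs (hasED h2 (hasE_cst P (1 - m)))) _ _ => [w|]; ring.
Qed.

End gaussian_rv_moments.

(** * Moments of Gaussian vectors *)

Lemma normrM_le_sqrD (R : realDomainType) (x y : R) :
  `|x * y| <= x ^+ 2 + y ^+ 2.
Proof.
have := sqr_ge0 (`|x| - `|y|); have := sqr_ge0 x; have := sqr_ge0 y.
rewrite sqrrB !real_normK ?num_real// normrM; lra.
Qed.

Section gaussian_process_moments.
Context d (Omega : measurableType d) (R : realType) (P : probability Omega R).
Context (I : Type) (Z : I -> Omega -> R).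
Hypothesis gZ : gaussian_process P Z.

Lemma gaussian_process_rv (p : I) : gaussian_rv P (Z p).
Proof.
have := gZ (fun _ : 'I_1 => p) (fun=> 1).
by under eq_fun do rewrite big_ord1 mul1r.
Qed.

Lemma gaussian_process_mean (p : I) : hasE P (Z p) (fine 'E_P[Z p]).
Proof.
have [m [s [Zm _ _ _]]] := gaussian_rv_moments (gaussian_process_rv p).
by have := Zm.2; rewrite unlock => ->.
Qed.

(** The hypothesis fixes only the value of an integral; integrability of the product comes from
    domination by the two centered squares. *)
Lemma gaussian_process_covariance (p q : I) (c : R) :
  covariance P (Z p) (Z q) = c%:E ->
  hasE P (fun w => (Z p w - fine 'E_P[Z p]) * (Z q w - fine 'E_P[Z q])) c.
Proof.
have cent r : exists v, measurable_fun setT (Z r) /\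
    hasE P (fun w => (Z r w - fine 'E_P[Z r]) ^+ 2) v.
  have [m [s [Zm Zs _ _]]] := gaussian_rv_moments (gaussian_process_rv r).
  have [mZ _] := gaussian_process_rv r.
  by exists (s ^+ 2); rewrite (hasE_unique (gaussian_process_mean r) Zm).
have [v [mp hp]] := cent p; have [v' [mq hq]] := cent q.
have mpq : measurable_fun setT
    (fun w => (Z p w - fine 'E_P[Z p]) * (Z q w - fine 'E_P[Z q])).
  by apply: measurable_funM; apply: measurable_funB.
have [e he] := hasE_dominated mpq (hasED hp hq) (fun w =>
  normrM_le_sqrD _ _).
rewrite covariance.unlock {1}expectation.unlock => hc.
by have [_] := he; rewrite [LHS]hc => -[ce]; rewrite ce.
Qed.

End gaussian_process_moments.

(* The combinations of two coordinates suffice: polarization recovers the mixed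
   moments. *)
Definition gaussian_moments d (E : measurableType d) (R : realType) (T : nat)
    (mu : probability E R) (z : 'I_T -> E -> R) (S : 'M[R]_T) : Prop :=
  S^T = S /\ forall i j c, let v := S i i + 2 * c * S i j + c ^+ 2 * S j j in
  let f := fun x => z i x + c * z j x in
  [/\ hasE mu f 0, hasE mu (fun x => f x ^+ 2) v,
      hasE mu (fun x => f x ^+ 4) (3 * v ^+ 2)
    & hasE mu (fun x => f x ^+ 6) (15 * v ^+ 3)].

(** A combination of two coordinates of [L *m (vec x - m)] is a centered linear combination of the
    coordinates of x, hence normal. Computing its second moment a second time from the covariances
    identifies the variance with [v]. *)
Lemma multivariate_gaussian_moments (R : realType) (T : nat)
    (mu : probability (T.-tuple R) R) (Sigma L : 'M[R]_T) :
  multivariate_gaussian mu Sigma -> Sigma^T = Sigma ->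
  exists m : 'cV[R]_T, gaussian_moments mu
    (fun i x => (L *m (vec x - m)) i ord0) (L *m Sigma *m L^T).
Proof.
move=> [g cov] symSigma.
pose m k := fine 'E_mu[fun x : T.-tuple R => tnth x k].
have symS : (L *m Sigma *m L^T)^T = L *m Sigma *m L^T.
  by rewrite !trmx_mul trmxK symSigma mulmxA.
exists (\col_k m k); split => //.
move=> i j c v f.
pose b k := L i k + c * L j k.
have fE x : f x = \sum_k b k * (tnth x k - m k).
  rewrite /f !mxE mulr_sumr -big_split/=; apply: eq_bigr => k _.
  by rewrite !mxE /b; ring.
have [m' [s [h1 h2 h4 h6]]] := gaussian_rv_moments (g T id b).
have m'E : m' = \sum_k b k * m k.
  apply: (hasE_unique h1).
  by apply: hasE_sum => k; apply: hasEZ; exact: (gaussian_process_mean g k).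
have fE' x : \sum_k b k * tnth x k - m' = f x.
  rewrite fE m'E -sumrB; apply: eq_bigr => k _; ring.
have vE : s ^+ 2 = v.
  have hv : hasE mu (fun x => \sum_k \sum_l (b k * b l) *
      ((tnth x k - m k) * (tnth x l - m l))) (\sum_k \sum_l (b k * b l) * Sigma k l).
    apply: hasE_sum => k; apply: hasE_sum => l; apply: (hasEZ (b k * b l)).
    exact: (gaussian_process_covariance g (cov k l)).
  have -> : s ^+ 2 = \sum_k \sum_l (b k * b l) * Sigma k l.
    apply: (hasE_unique h2); apply: hasE_eq hv _ _ => // x.
    rewrite /= fE' fE expr2 big_distrlr/=; apply: eq_bigr => k _.
    by apply: eq_bigr => l _; ring.
  have SE (i' j' : 'I_T) : (L *m Sigma *m L^T) i' j' =
      \sum_k \sum_l (L i' k * L j' l) * Sigma k l.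
    rewrite mxE exchange_big/=; apply: eq_bigr => l _; rewrite !mxE mulr_suml.
    by apply: eq_bigr => k _; ring.
  (* Expanding the square produces both S i j and S j i; symmetry merges them into the term
     [2 * c * S i j] of [v]. *)
  have Sji : (L *m Sigma *m L^T) i j = \sum_k \sum_l (L j k * L i l) * Sigma k l.
    by rewrite -SE -[in LHS]symS [LHS]mxE.
  rewrite /v mulr2n !mulrDl mul1r {2}Sji !SE !mulr_sumr -!big_split/=.
  apply: eq_bigr => k _; rewrite !mulr_sumr -!big_split/=.
  by apply: eq_bigr => l _; rewrite /b; ring.
split.
- apply: hasE_eq (hasEB h1 (hasE_cst mu m')) _ _ => [x|]; first exact: fE'.
  by rewrite subrr.
- by apply: hasE_eq h2 _ _ => [x|//]; rewrite -fE'.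
- by apply: hasE_eq h4 _ _ => [x|]; rewrite -?fE'// -vE -exprM.
- by apply: hasE_eq h6 _ _ => [x|]; rewrite -?fE'// -vE -exprM.
Qed.

Section wick.
Context d (E : measurableType d) (R : realType) (T : nat).
Context (mu : probability E R) (z : 'I_T -> E -> R) (S : 'M[R]_T).
Hypothesis gz : gaussian_moments mu z S.

Lemma gaussian_moments_mean i : hasE mu (z i) 0.
Proof.
have [_ /(_ i i 0) [h _ _ _]] := gz; apply: hasE_eq h _ _ => // x; ring.
Qed.

Lemma gaussian_moments_sixth i : hasE mu (fun x => z i x ^+ 6) (15 * S i i ^+ 3).
Proof.
have [_ /(_ i i 0) [_ _ _ h]] := gz.
by apply: hasE_eq h _ _ => [x|]; [congr (_ ^+ _)|congr (_ * _ ^+ _)]; ring.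
Qed.

Lemma gaussian_moments_cov i j : hasE mu (fun x => z i x * z j x) (S i j).
Proof.
have [_ gij] := gz.
have [_ h1 _ _] := gij i j 1; have [_ h2 _ _] := gij i j (- 1).
by apply: hasE_eq (hasEZ (4^-1) (hasEB h1 h2)) _ _ => [x|] /=; field.
Qed.

(** Isserlis formula by polarization: (a + b)^4 + (a - b)^4 - 2 (a^4 + b^4) = 12 a^2 b^2. *)
Lemma gaussian_moments_wick i j : hasE mu (fun x => z i x ^+ 2 * z j x ^+ 2)
  (S i i * S j j + 2 * S i j ^+ 2).
Proof.
have [_ gij] := gz.
have [_ _ h1 _] := gij i j 1; have [_ _ h2 _] := gij i j (- 1).
have [_ _ hi _] := gij i i 0; have [_ _ hj _] := gij j j 0.
apply: hasE_eq (hasEZ (12^-1) (hasEB (hasED h1 h2) (hasEZ 2 (hasED hi hj)))) _ _.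
  by move=> x /=; field.
by field.
Qed.

(** Existence of a value suffices: in the expansions below each third moment is multiplied by a
    mean, which is 0. The bound is |z_j| <= 1 + z_j^2. *)
Lemma gaussian_moments_third i j : exists e, hasE mu (fun x => z i x ^+ 2 * z j x) e.
Proof.
have mz k := hasE_measurable (gaussian_moments_mean k).
apply: (@hasE_dominated _ _ _ _ _ (fun x => z i x * z i x + z i x ^+ 2 * z j x ^+ 2)).
- by apply: measurable_funM => //; exact: measurable_funX.
- exact: hasED (gaussian_moments_cov i i) (gaussian_moments_wick i j).
- move=> x; rewrite normrM -expr2 ger0_norm ?sqr_ge0// -[X in _ <= X + _]mulr1 -mulrDr.
  apply: ler_wpM2l; first exact: sqr_ge0.
  have := sqr_ge0 (`|z j x| - 1); have := sqr_ge0 (z j x).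
  rewrite sqrrB1 real_normK ?num_real//; lra.
Qed.

Lemma gaussian_moments_diag_ge0 i : 0 <= S i i.
Proof.
apply: hasE_le (hasE_cst mu 0) (gaussian_moments_cov i i) _ => x.
by rewrite -expr2 sqr_ge0.
Qed.

End wick.

(** * Independence *)

Section product_law.
Context d d1 d2 (X : measurableType d) (E1 : measurableType d1)
  (E2 : measurableType d2) (R : realType).

(** Rectangles determine the product measure. [mu] is a general measure so that the lemma applies to
    restrictions of a probability in [iid3_law_X_YW]. *)
Lemma pair_law (mu : {measure set X -> \bar R})
    (m1 : {sigma_finite_measure set E1 -> \bar R})
    (m2 : {sigma_finite_measure set E2 -> \bar R}) (f : X -> E1) (g : X -> E2) :
  measurable_fun [set: X] f -> measurable_fun [set: X] g ->
  (forall A B, measurable A -> measurable B ->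
    mu (f @^-1` A `&` g @^-1` B) = (m1 A * m2 B)%E) ->
  forall D, measurable D -> mu ((fun x => (f x, g x)) @^-1` D) = (m1 \x m2)%E D.
Proof.
move=> mf mg H D mD.
have mfg : measurable_fun [set: X] (fun x => (f x, g x)).
  exact: measurable_fun_pair.
pose mphi_mixin := isMeasurableFun.Build _ _ _ _ _ mfg.
pose mphi_pack : {mfun _ >-> _} := HB.pack (fun x => (f x, g x)) mphi_mixin.
by rewrite (@product_measure_unique _ _ _ _ _ m1 m2 (pushforward mu mphi_pack)).
Qed.

Lemma hasE_product (m1 : {sigma_finite_measure set E1 -> \bar R})
    (m2 : {sigma_finite_measure set E2 -> \bar R}) (f : E1 -> R) (g : E2 -> R)
    (a b : R) :
  hasE m1 f a -> hasE m2 g b ->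
  hasE (m1 \x m2)%E (fun z => f z.1 * g z.2) (a * b).
Proof.
move=> fa gb.
have mfg : measurable_fun [set: E1 * E2] (EFin \o (fun z => f z.1 * g z.2)).
  apply/measurable_EFinP/measurable_funM.
  - exact: measurableT_comp (hasE_measurable fa) measurable_fst.
  - exact: measurableT_comp (hasE_measurable gb) measurable_snd.
have [fi fe] := fa; have [gi ge] := gb.
have ifg : (m1 \x m2)%E.-integrable [set: E1 * E2]
    (EFin \o (fun z => f z.1 * g z.2)).
  apply/integrable12ltyP => //=.
  have /integrableP[_ flt] := fi; have /integrableP[mg glt] := gi.
  have mg' : measurable_fun [set: E2] (fun y => `|g y|%:E).
    by apply/measurable_EFinP; apply: measurableT_comp => //; exact: hasE_measurable gb.
  have mf' : measurable_fun [set: E1] (fun x => `|f x|%:E).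
    by apply/measurable_EFinP; apply: measurableT_comp => //; exact: hasE_measurable fa.
  have gfin : (\int[m2]_y `|g y|%:E)%E \is a fin_num.
    by rewrite ge0_fin_numE// integral_ge0.
  under eq_integral.
    move=> x _; under eq_integral do rewrite normrM EFinM.
    rewrite ge0_integralZl// muleC -(fineK gfin); over.
  rewrite ge0_integralZl//; last by rewrite lee_fin fine_ge0// integral_ge0.
  by rewrite lte_mul_pinfty// lee_fin fine_ge0// integral_ge0.
split => //; rewrite -integral12_prod_meas1//.
rewrite /fubini_F.
under eq_integral.
  move=> x _ /=; under eq_integral do rewrite EFinM.
  rewrite integralZl// ge muleC; over.
by rewrite integralZl// fe -EFinM mulrC.
Qed.

End product_law.

(** (f, g) and (g, f) have the same law, and exchanging the arguments turns the negative part of [G]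
    into its positive part, so both parts have equal integrals. If these are infinite, their
    difference is -oo, which [fine] sends to 0. *)
Lemma fine_expectation_skew d (Omega : measurableType d) (R : realType)
    (Q : probability Omega R) d' (E : measurableType d') (mu : probability E R)
    (f g : Omega -> E) (G : E * E -> R) :
  measurable_fun [set: Omega] f -> measurable_fun [set: Omega] g ->
  (forall A B, measurable A -> measurable B ->
    Q (f @^-1` A `&` g @^-1` B) = (mu A * mu B)%E) ->
  measurable_fun [set: E * E] G -> (forall x y, G (y, x) = - G (x, y)) ->
  fine 'E_Q[fun v => G (f v, g v)] = 0.
Proof.
move=> mf mg H mG skew.
pose Gp : E * E -> \bar R := (fun z => maxe (G z)%:E 0)%E.
have mGp : measurable_fun [set: E * E] Gp.
  by apply: measurable_maxe; [exact/measurable_EFinP|exact: measurable_cst].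
have Gp0 z : (0 <= Gp z)%E by rewrite le_max lexx orbT.
pose pi2 : probability (E * E)%type R := (mu \x mu)%E.
have lawfg : forall D, measurable D -> Q ((fun x => (f x, g x)) @^-1` D) = pi2 D.
  exact: pair_law.
have Hgf A B : measurable A -> measurable B ->
    Q (g @^-1` A `&` f @^-1` B) = (mu A * mu B)%E.
  by move=> mA mB; rewrite setIC H// muleC.
have lawgf : forall D, measurable D -> Q ((fun x => (g x, f x)) @^-1` D) = pi2 D.
  exact: pair_law.
have mfg : measurable_fun [set: Omega] (fun x => (f x, g x)).
  exact: measurable_fun_pair.
have mgf : measurable_fun [set: Omega] (fun x => (g x, f x)).
  exact: measurable_fun_pair.
rewrite expectation.unlock integralE.
have -> : (\int[Q]_x (fun v => (G (f v, g v))%:E)^\+ x)%E = (\int[pi2]_z Gp z)%E.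
  rewrite -(ge0_integral_law (nu := pi2) mfg lawfg mGp Gp0).
  by apply: eq_integral => v _; rewrite /Gp unlock.
have -> : (\int[Q]_x (fun v => (G (f v, g v))%:E)^\- x)%E = (\int[pi2]_z Gp z)%E.
  rewrite -(ge0_integral_law (nu := pi2) mgf lawgf mGp Gp0).
  by apply: eq_integral => v _; rewrite /Gp skew unlock.
have : (0 <= \int[pi2]_z Gp z)%E by exact: integral_ge0.
by case: (\int[pi2]_z Gp z)%E => [r| |]//= _; rewrite subrr.
Qed.

Section iid.
Context d (Omega : measurableType d) (R : realType) (Q : probability Omega R).
Context d' (E : measurableType d') (pi_X : probability E R).
Context (X Y W : {RV Q >-> E}).
Hypothesis iid : iid3 pi_X X Y W.

Lemma iid3_law (A B C : set E) : measurable A -> measurable B -> measurable C ->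
  Q (X @^-1` A `&` (Y @^-1` B `&` W @^-1` C)) = (pi_X A * (pi_X B * pi_X C))%E.
Proof.
move=> mA mB mC; rewrite setIA; case: iid => marg ->//.
have [XA _ _] := marg _ mA; have [_ YB _] := marg _ mB; have [_ _ WC] := marg _ mC.
by move: XA YB WC; rewrite /distribution/= /pushforward => -> -> ->; rewrite muleA.
Qed.

(** For fixed [A], restricting [Q] to the event that X lies in [A] gives (Y, W) the product law
    scaled by [pi_X A]; [pair_law] then passes from rectangles to every measurable [D]. *)
Lemma iid3_law_X_YW (A : set E) (D : set (E * E)) :
  measurable A -> measurable D ->
  Q (X @^-1` A `&` (fun v => (Y v, W v)) @^-1` D) =
  (pi_X A * (pi_X \x pi_X) D)%E.
Proof.
move=> mA mD.
have mXA : measurable (X @^-1` A) by rewrite -[_ @^-1` _]setTI; exact: measurable_funP.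
have pA0 : 0 <= fine (pi_X A) by exact: fine_ge0.
pose m1 := mscale (NngNum pA0) pi_X.
rewrite setIC.
have -> : (pi_X A * (pi_X \x pi_X) D = (m1 \x pi_X) D)%E.
  rewrite /product_measure1 ge0_integral_mscale//=.
  - by rewrite fineK// fin_num_measure.
  - exact: measurable_fun_xsection.
apply: (@pair_law _ _ _ _ _ _ _ (mrestr Q mXA) m1 pi_X) => // B C mB mC.
have := iid3_law mA mB mC; rewrite setIC => H; rewrite [LHS]H muleA.
by rewrite -[in LHS](fineK (fin_num_measure pi_X A mA)).
Qed.

Lemma hasE_iid3 (f g h : E -> R) (a b c : R) :
  hasE pi_X f a -> hasE pi_X g b -> hasE pi_X h c ->
  hasE Q (fun v => f (X v) * (g (Y v) * h (W v))) (a * (b * c)).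
Proof.
move=> fa gb hc.
have mYW : measurable_fun [set: Omega] (fun v => (Y v, W v)).
  exact: measurable_fun_pair.
pose pi2 : probability (E * E)%type R := (pi_X \x pi_X)%E.
have mX : measurable_fun [set: Omega] X by [].
have law := pair_law (m2 := pi2) mX mYW iid3_law_X_YW.
have mXYW : measurable_fun [set: Omega] (fun v => (X v, (Y v, W v))).
  exact: measurable_fun_pair.
pose pi3 : probability (E * (E * E))%type R := (pi_X \x pi2)%E.
have H2 : hasE pi2 (fun z => g z.1 * h z.2) (b * c) := hasE_product gb hc.
have H3 : hasE pi3 (fun z => f z.1 * (g z.2.1 * h z.2.2)) (a * (b * c)) :=
  hasE_product fa H2.
exact: (hasE_law (nu := pi3) mXYW law H3).
Qed.

End iid.

(** * Positive definite matrices *)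

Section matrices.
Variable R : realType.

Lemma posdefmx_unit (T : nat) (A : 'M[R]_T) : posdefmx A -> A \in unitmx.
Proof.
move=> [symA pos]; rewrite -row_free_unit -kermx_eq0; apply/eqP/row_matrixP => i.
rewrite row0; apply/eqP/negPn/negP => ri0.
have /pos : (row i (kermx A))^T != 0 by rewrite trmx_eq0.
by rewrite trmxK -row_mul mulmx_ker row0 mul0mx mxE ltxx.
Qed.

Lemma posdefmx_inv (T : nat) (A : 'M[R]_T) : posdefmx A -> posdefmx (invmx A).
Proof.
move=> pA; have uA := posdefmx_unit pA; have [symA pos] := pA.
have symV : (invmx A)^T = invmx A by rewrite trmx_inv symA.
split => // x x0.
have y0 : invmx A *m x != 0.
  apply: contraNneq x0 => y0; apply/eqP.
  by rewrite -(mulKVmx uA x) y0 mulmx0.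
have := pos _ y0; rewrite trmx_mul symV -!mulmxA (mulmxA A) mulmxV// mul1mx.
by rewrite mulmxA.
Qed.

(** Induction on the size: the Schur complement [S] of the upper left entry is again positive
    definite, and its factor completes an upper triangular one. *)
Lemma posdefmx_cholesky (T : nat) (A : 'M[R]_T) : posdefmx A ->
  exists L : 'M[R]_T, A = L^T *m L.
Proof.
elim: T A => [|n ih] A; first by exists 0; apply/matrixP => -[].
rewrite -[n.+1]/(1 + n)%N in A *.
rewrite -(submxK A).
set a := ulsubmx A; set b := ursubmx A; set c := dlsubmx A; set D := drsubmx A.
move=> [sym pos].
have [cE symD] : c = b^T /\ D^T = D.
  by move: sym; rewrite tr_block_mx => /eq_block_mx[_ _ <- ->].
pose al := a ord0 ord0.
have aE : a = al%:M by rewrite [a]mx11_scalar.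
have al0 : 0 < al.
  have := pos (col_mx 1%:M 0).
  rewrite tr_col_mx trmx0 tr_scalar_mx mul_row_block mul_row_col !mul1mx !mul0mx.
  rewrite mulmx0 !addr0 mulmx1; apply.
  apply/eqP => /(congr1 usubmx); rewrite col_mxKu linear0 => /matrixP/(_ ord0 ord0).
  by rewrite !mxE/= => /eqP; rewrite oner_eq0.
pose S := D - al^-1 *: (c *m b).
have pS : posdefmx S.
  split; first by rewrite /S linearB linearZ/= symD trmx_mul cE trmxK.
  move=> x x0.
  (* This first coordinate minimizes the quadratic form for given [x]; the minimum is the form of
     [S] at [x]. *)
  have := pos (col_mx (- al^-1 *: (b *m x)) x).
  have nz : col_mx (- al^-1 *: (b *m x)) x != 0.
    by apply: contraNneq x0 => /(congr1 dsubmx); rewrite col_mxKd linear0 => ->.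
  move=> /(_ nz); congr (0 < fun_of_matrix _ _ _).
  rewrite tr_col_mx mul_row_block mul_row_col aE /S cE.
  have -> : (- al^-1 *: (b *m x))^T = - al^-1 *: (x^T *m b^T).
    by rewrite [LHS]linearZ/= trmx_mul.
  rewrite mul_mx_scalar scalerA mulrN mulfV ?gt_eqF// scaleN1r.
  rewrite addNr mul0mx add0r mulmxDl mulmxBr mulmxBl -scalemxAl addrC; congr (_ + _).
  by rewrite -scalemxAr -!scalemxAl scaleNr !mulmxA.
have [L' SE] := ih _ pS.
exists (block_mx (Num.sqrt al)%:M ((Num.sqrt al)^-1 *: b) 0 L').
have sq0 : Num.sqrt al != 0 by rewrite gt_eqF// sqrtr_gt0.
rewrite tr_block_mx mulmx_block !trmx0 tr_scalar_mx !mul0mx !mulmx0 !addr0.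
congr block_mx.
- by rewrite -scalar_mxM -expr2 sqr_sqrtr ?ltW.
- by rewrite mul_scalar_mx scalerA mulfV// scale1r.
- by rewrite linearZ/= mul_mx_scalar scalerA mulfV// scale1r.
- have -> : ((Num.sqrt al)^-1 *: b)^T = (Num.sqrt al)^-1 *: b^T.
    by rewrite [LHS]linearZ.
  rewrite -SE /S -scalemxAl -scalemxAr scalerA -expr2 exprVn.
  by rewrite sqr_sqrtr ?ltW// -cE addrC subrK.
Qed.

Lemma similar_mxtrace (T : nat) (P A B : 'M[R]_T) :
  P \in unitmx -> P *m A = B *m P -> \tr A = \tr B.
Proof.
move=> uP PA; rewrite -[A](mulKmx uP) PA mxtrace_mulC mulmxK//.
Qed.

End matrices.

(** Up to sign, both sides are the subleading coefficient of the characteristic polynomial; size 0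
    has no such coefficient and is treated apart. *)
Lemma eigenvalues_of_mxtrace (R : realType) (T : nat) (A : 'M[R]_T)
    (lam : 'I_T -> R) : eigenvalues_of A lam -> \tr A = \sum_j lam j.
Proof.
rewrite /eigenvalues_of; case: T A lam => [|n] A lam charA.
  by rewrite big_ord0 [\tr A]big_ord0.
apply: oppr_inj; rewrite -char_poly_trace// charA.
have := @coefPn_prod_XsubC _ [seq lam j | j <- index_enum 'I_n.+1].
have sz : size (index_enum 'I_n.+1) = n.+1.
  by rewrite -[RHS]size_enum_ord [index_enum _]unlock -enumT.
by rewrite !big_map size_map sz => /(_ isT).
Qed.

Lemma det_map_comp_poly (R : comNzRingType) (T : nat) (A : 'M[{poly R}]_T)
    (q : {poly R}) : \det (map_mx (comp_poly q) A) = \det A \Po q.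
Proof. by rewrite det_map_mx. Qed.

(* [X^2 - A^2 = (X - A) (X + A)], and [\det (X + A)] is [char_poly A] at [-X]
   up to sign. *)
Lemma eigenvalues_of_sqr (R : realType) (T : nat) (A : 'M[R]_T)
    (lam : 'I_T -> R) : eigenvalues_of A lam ->
  eigenvalues_of (A *m A) (fun j => lam j ^+ 2).
Proof.
move=> charA; rewrite /eigenvalues_of.
pose B : 'M[{poly R}]_T := map_mx polyC A.
have detm : \det ('X%:M - B) = \prod_j ('X - (lam j)%:P) by exact: charA.
have detp : \det ('X%:M + B) = \prod_j ('X + (lam j)%:P).
  have -> : 'X%:M + B = (-1) *: map_mx (comp_poly (- 'X)) ('X%:M - B).
    apply/matrixP => i j; rewrite !mxE; case: (i == j).
    - by rewrite !mulr1n linearB/= comp_polyX comp_polyC mulN1r opprB opprK addrC.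
    - by rewrite !mulr0n !sub0r linearN/= comp_polyC mulN1r opprK add0r.
  rewrite detZ det_map_comp_poly detm rmorph_prod/=.
  rewrite -[X in (-1) ^+ X](card_ord T) -prodr_const -big_split/=.
  apply: eq_bigr => j _.
  by rewrite linearB/= comp_polyX comp_polyC mulN1r opprB opprK addrC.
(* Substituting X^2 for X is injective on polynomials, so the identity may be checked after this
   substitution, where the factorization applies. *)
apply/eqP; rewrite -subr_eq0 -(@comp_poly_eq0 _ _ 'X^2) ?size_polyXn//.
rewrite linearB/= subr_eq0; apply/eqP.
rewrite /char_poly -det_map_comp_poly rmorph_prod/=.
have -> : map_mx (comp_poly 'X^2) (char_poly_mx (A *m A)) = ('X%:M - B) *m ('X%:M + B).
  rewrite mulmxBl !mulmxDr -scalar_mxM -scalar_mxC opprD addrA addrK.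
  rewrite -map_mxM; apply/matrixP => i j; rewrite !mxE.
  case: (i == j).
  - by rewrite !mulr1n linearB/= comp_polyX comp_polyC expr2.
  - by rewrite !mulr0n !sub0r linearN/= comp_polyC.
rewrite det_mulmx detm detp -big_split/=; apply: eq_bigr => j _.
by rewrite linearB/= comp_polyX comp_polyC rmorphXn/= -subr_sqr.
Qed.

(** A left eigenvector of [M] gives a row w with w B = lam w A, so lam is the quotient of two
    positive numbers, w B w^T and w A w^T. *)
Lemma eigenvalues_of_similar_posdef_gt0 (R : realType) (T : nat)
    (A B M P : 'M[R]_T) (lam : 'I_T -> R) :
  posdefmx A -> posdefmx B -> P \in unitmx -> P *m M = invmx A *m B *m P ->
  eigenvalues_of M lam -> forall j, 0 < lam j.
Proof.
move=> pA pB uP simM charM j.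
have uA := posdefmx_unit pA.
have : eigenvalue M (lam j).
  rewrite eigenvalue_root_char charM /root horner_prod.
  by apply/prodf_eq0; exists j => //; rewrite hornerXsubC subrr.
move=> /eigenvalueP[v vM v0].
pose w := v *m invmx P *m invmx A.
have w0 : w^T != 0.
  rewrite trmx_eq0; apply: contraNneq v0 => w0.
  by rewrite -(mulmxKV uP v) -(mulmxKV uA (v *m invmx P)) -/w w0 !mul0mx.
have wB : w *m B = lam j *: (w *m A).
  have AB : invmx A *m B = P *m M *m invmx P by rewrite simM mulmxK.
  rewrite /w mulmxKV// -(mulmxA _ _ B) AB -!mulmxA (mulKmx uP) mulmxA vM.
  by rewrite scalemxAl.
have [_ /(_ _ w0) hA] := pA; have [_ /(_ _ w0) hB] := pB.
by move: hB; rewrite trmxK wB -scalemxAl mxE pmulr_lgt0// -[w in w *m A]trmxK.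
Qed.

(** * Moments of the squared distance *)

Section inequalities.
Variable R : realType.

(** Mean value theorem for a function that vanishes at 0 and has a nonnegative derivative.
    Differentiation lowers the Taylor order, so each Taylor bound follows from the preceding one. *)
Lemma polyDexpRN_ge0 (p : {poly R}) (c : R) :
  (forall x, 0 <= x -> 0 <= p^`().[x] - c * expR (- x)) -> p.[0] + c = 0 ->
  forall x, 0 <= x -> 0 <= p.[x] + c * expR (- x).
Proof.
move=> p'0 p0 x x0.
pose F : R -> R := (horner p : R -> R) + c \*: ((expR \o -%R) : R -> R).
have dF (y : R) : is_derive y (1 : R) F (p^`().[y] - c * expR (- y)).
  by apply: is_derive_eq; rewrite mulrN1 scalerN.
have [|y] := @MVT_segment _ F _ 0 x x0 (fun y _ => dF y).
- apply: continuous_subspaceT => y'; apply: differentiable_continuous.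
  exact/derivable1_diffP.
rewrite in_itv/= => /andP[y0 _] /eqP; rewrite subr_eq => /eqP.
rewrite [F 0](_ : _ = 0) ?addr0; last first.
  by rewrite /F !fctE/= oppr0 expR0 -[RHS]p0 /GRing.scale/= mulr1.
by rewrite subr0 => FE; rewrite -[leRHS]/(F x) FE mulr_ge0// p'0.
Qed.

Lemma expRN_le_taylor2 (x : R) : 0 <= x -> expR (- x) <= 1 - x + x ^+ 2 / 2.
Proof.
move=> x0.
have : 0 <= (1 - 'X + (2^-1)%:P * 'X^2).[x] + (- 1) * expR (- x).
  apply: polyDexpRN_ge0 x0 => [y y0|]; last by rewrite !hornerE /=; lra.
  rewrite !poly.derivE !hornerE /=; have := expR_ge1Dx (- y); lra.
rewrite !hornerE /=; lra.
Qed.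

Lemma expRN_ge_taylor3 (x : R) : 0 <= x -> 1 - x + x ^+ 2 / 2 - x ^+ 3 <= expR (- x).
Proof.
move=> x0.
have : 0 <= (- 1 + 'X - (2^-1)%:P * 'X^2 + (6^-1)%:P * 'X^3).[x] + 1 * expR (- x).
  apply: polyDexpRN_ge0 x0 => [y y0|]; last by rewrite !hornerE /=; lra.
  rewrite !poly.derivE !hornerE /=; have := expRN_le_taylor2 y0; lra.
have := exprn_ge0 3 x0; rewrite !hornerE /=; lra.
Qed.

(** The sum is at most T times its largest term, whose cube occurs on the right. *)
Lemma expr3_sum_le (T : nat) (x : 'I_T -> R) : (forall i, 0 <= x i) ->
  (\sum_i x i) ^+ 3 <= T%:R ^+ 3 * \sum_i x i ^+ 3.
Proof.
case: T x => [|n] x x0; first by rewrite !big_ord0 expr0n/= mulr0.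
have [m _ xm] := @arg_maxP _ _ _ (ord0 : 'I_n.+1) predT x isT.
have le1 : \sum_i x i <= n.+1%:R * x m.
  rewrite mulr_natl -[X in _ *+ X](card_ord n.+1) -sumr_const.
  by apply: ler_sum => i _; exact: xm.
apply: (le_trans (lerXn2r 3 _ _ le1)); rewrite ?nnegrE ?sumr_ge0 ?mulr_ge0//.
rewrite exprMn ler_wpM2l ?exprn_ge0// (bigD1 m)//= lerDl.
by apply: sumr_ge0 => i _; rewrite exprn_ge0.
Qed.

Lemma sum_expr3_le (T : nat) (x : 'I_T -> R) : (forall i, 0 <= x i) ->
  \sum_i x i ^+ 3 <= (\sum_i x i) ^+ 3.
Proof.
move=> x0; rewrite exprS mulr_suml; apply: ler_sum => i _.
rewrite exprS ler_wpM2l// lerXn2r ?nnegrE ?sumr_ge0//.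
by rewrite (bigD1 i)//= lerDl sumr_ge0.
Qed.

(** 32 = 2^3 * 4: cube (a - b)^2 <= 2 (a^2 + b^2), then apply (u + v)^3 <= 4 (u^3 + v^3). *)
Lemma expr6B_le (a b : R) : (a - b) ^+ 6 <= 32 * (a ^+ 6 + b ^+ 6).
Proof.
have le1 : (a - b) ^+ 2 <= 2 * (a ^+ 2 + b ^+ 2).
  have := sqr_ge0 (a + b); rewrite sqrrB sqrrD; lra.
have le2 (u v : R) : 0 <= u -> 0 <= v -> (u + v) ^+ 3 <= 4 * (u ^+ 3 + v ^+ 3).
  move=> u0 v0; rewrite -subr_ge0.
  rewrite (_ : _ - _ = 3 * ((u + v) * (u - v) ^+ 2)); last by ring.
  by apply: mulr_ge0 => //; apply: mulr_ge0; [exact: addr_ge0|exact: sqr_ge0].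
rewrite (exprM _ 2 3); apply: (le_trans (lerXn2r 3 _ _ le1)).
- by rewrite nnegrE sqr_ge0.
- by rewrite nnegrE; apply: mulr_ge0 => //; apply: addr_ge0; exact: sqr_ge0.
have := le2 (a ^+ 2) (b ^+ 2) (sqr_ge0 _) (sqr_ge0 _).
rewrite -!exprM exprMn; lra.
Qed.

End inequalities.

(** For [z] the coordinates of L (x - m), with Sigma_u^-1 = L^T L, this is the quadratic form q; m
    cancels in the differences but makes the [z i] centered. *)
Definition sqdist (R : realType) (E : Type) (T : nat) (z : 'I_T -> E -> R)
  (x y : E) : R := \sum_i (z i x - z i y) ^+ 2.

Lemma sqdist_ge0 (R : realType) (E : Type) (T : nat) (z : 'I_T -> E -> R)
  (x y : E) : 0 <= sqdist z x y.
Proof. by apply: sumr_ge0 => i _; rewrite sqr_ge0. Qed.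

Section sqdist_moments.
Context d (Omega : measurableType d) (R : realType) (Q : probability Omega R).
Context d' (E : measurableType d') (mu : probability E R).
Context (T : nat) (z : 'I_T -> E -> R) (S : 'M[R]_T).
Hypothesis gz : gaussian_moments mu z S.

Let t := \tr S.
Let p := \sum_i \sum_j S i j ^+ 2.

Let tE : t = \sum_i S i i. Proof. by []. Qed.

Let t2E : t ^+ 2 = \sum_i \sum_j S i i * S j j.
Proof. by rewrite expr2 tE big_distrlr. Qed.

Section pair.
Variables (A B : Omega -> E).
Hypothesis indep : forall f g a b, hasE mu f a -> hasE mu g b ->
  hasE Q (fun v => f (A v) * g (B v)) (a * b).

Let indepl f a : hasE mu f a -> hasE Q (fun v => f (A v)) a.
Proof.
by move=> h; apply: hasE_eq (indep h (hasE_cst mu 1)) _ _ => [v|]; rewrite mulr1.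
Qed.

Let indepr f a : hasE mu f a -> hasE Q (fun v => f (B v)) a.
Proof.
by move=> h; apply: hasE_eq (indep (hasE_cst mu 1) h) _ _ => [v|]; rewrite mul1r.
Qed.

Lemma hasE_sqdist : hasE Q (fun v => sqdist z (A v) (B v)) (2 * t).
Proof.
rewrite tE mulr_sumr; apply: hasE_sum => i.
have h := gaussian_moments_cov gz i i; have m := gaussian_moments_mean gz i.
by apply: hasE_eq
  (hasEB (hasED (indepl h) (indepr h)) (hasEZ 2 (indep m m))) _ _ => [v|] /=; ring.
Qed.

Lemma hasE_sqdist_sqr :
  hasE Q (fun v => sqdist z (A v) (B v) ^+ 2) (4 * t ^+ 2 + 8 * p).
Proof.
have -> : 4 * t ^+ 2 + 8 * p =
    \sum_i \sum_j (4 * (S i i * S j j) + 8 * S i j ^+ 2).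
  rewrite t2E !mulr_sumr -big_split/=; apply: eq_bigr => i _.
  by rewrite !mulr_sumr -big_split.
have H i j : hasE Q
    (fun v => (z i (A v) - z i (B v)) ^+ 2 * (z j (A v) - z j (B v)) ^+ 2)
    (4 * (S i i * S j j) + 8 * S i j ^+ 2).
  have mi := gaussian_moments_mean gz i; have mj := gaussian_moments_mean gz j.
  have cii := gaussian_moments_cov gz i i; have cjj := gaussian_moments_cov gz j j.
  have cij := gaussian_moments_cov gz i j; have w := gaussian_moments_wick gz i j.
  have [e eij] := gaussian_moments_third gz i j.
  have [e' eji] := gaussian_moments_third gz j i.
  (* [even] collects the monomials of even degree in each endpoint. Every monomial in [odd] has a
     factor of degree one in one endpoint, hence expectation 0. *)
  have even := hasED (hasED (hasED (indepl w) (indepr w))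
    (hasED (indep cii cjj) (indep cjj cii))) (hasEZ 4 (indep cij cij)).
  have odd := hasEZ 2 (hasED (hasED (indep eij mj) (indep eji mi))
    (hasED (indep mi eji) (indep mj eij))).
  by apply: hasE_eq (hasEB even odd) _ _ => [v|] /=; ring.
apply: hasE_eq (hasE_sum _ (fun i => hasE_sum _ (H i))) _ erefl => v.
by rewrite /sqdist expr2 big_distrlr.
Qed.

(** An explicit majorant replaces the third moment of q: T^3 comes from moving the cube inside the
    sum, and 960 = 32 * (15 + 15) from [expr6B_le] and the two normal sixth moments. *)
Lemma sqdist_cube_bound : exists f e, [/\ hasE Q f e,
  forall v, sqdist z (A v) (B v) ^+ 3 <= f v & e <= 960 * T%:R ^+ 3 * t ^+ 3].
Proof.
have h6 i := gaussian_moments_sixth gz i.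
exists (fun v => T%:R ^+ 3 * \sum_i 32 * (z i (A v) ^+ 6 + z i (B v) ^+ 6)).
exists (T%:R ^+ 3 * \sum_i 32 * (15 * S i i ^+ 3 + 15 * S i i ^+ 3)); split.
- apply: hasEZ; apply: hasE_sum => i; apply: hasEZ.
  by apply: hasED; [exact: (indepl (h6 i))|exact: (indepr (h6 i))].
- move=> v; apply: le_trans (expr3_sum_le _) _; first by move=> i; exact: sqr_ge0.
  rewrite ler_wpM2l ?exprn_ge0//; apply: ler_sum => i _.
  by rewrite -exprM expr6B_le.
- rewrite [leRHS](_ : _ = T%:R ^+ 3 * (960 * t ^+ 3)); last by ring.
  rewrite ler_wpM2l ?exprn_ge0//.
  rewrite (_ : \sum_i _ = 960 * \sum_i S i i ^+ 3); last first.
    by rewrite mulr_sumr; apply: eq_bigr => i _; ring.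
  apply: ler_wpM2l; first exact: ler0n.
  rewrite tE; apply: sum_expr3_le => i; exact: (gaussian_moments_diag_ge0 gz).
Qed.

End pair.

(** Only the term in X alone contributes S i j ^ 2, since the cross term contains the means at Y and
    W; hence 2 p here against 8 p for the square of one distance. *)
Lemma hasE_sqdist_shared (X Y W : Omega -> E) :
  (forall f g h a b c, hasE mu f a -> hasE mu g b -> hasE mu h c ->
    hasE Q (fun v => f (X v) * (g (Y v) * h (W v))) (a * (b * c))) ->
  hasE Q (fun v => sqdist z (X v) (W v) * sqdist z (X v) (Y v))
    (4 * t ^+ 2 + 2 * p).
Proof.
move=> indep.
have -> : 4 * t ^+ 2 + 2 * p =
    \sum_i \sum_j (4 * (S i i * S j j) + 2 * S i j ^+ 2).
  rewrite t2E !mulr_sumr -big_split/=; apply: eq_bigr => i _.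
  by rewrite !mulr_sumr -big_split.
have H i j : hasE Q
    (fun v => (z i (X v) - z i (W v)) ^+ 2 * (z j (X v) - z j (Y v)) ^+ 2)
    (4 * (S i i * S j j) + 2 * S i j ^+ 2).
  have mi := gaussian_moments_mean gz i; have mj := gaussian_moments_mean gz j.
  have cii := gaussian_moments_cov gz i i; have cjj := gaussian_moments_cov gz j j.
  have cij := gaussian_moments_cov gz i j; have w := gaussian_moments_wick gz i j.
  have [e eij] := gaussian_moments_third gz i j.
  have [e' eji] := gaussian_moments_third gz j i.
  have c1 := hasE_cst mu 1.
  have even := hasED (hasED (indep _ _ _ _ _ _ w c1 c1) (indep _ _ _ _ _ _ cii cjj c1))
    (hasED (indep _ _ _ _ _ _ cjj c1 cii) (indep _ _ _ _ _ _ c1 cjj cii)).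
  have odd1 := hasED (indep _ _ _ _ _ _ eij mj c1) (indep _ _ _ _ _ _ eji c1 mi).
  have odd2 := hasED (indep _ _ _ _ _ _ mi cjj mi) (indep _ _ _ _ _ _ mj mj cii).
  have cross := hasEZ 4 (indep _ _ _ _ _ _ cij mj mi).
  by apply: hasE_eq (hasEB (hasED even cross) (hasEZ 2 (hasED odd1 odd2))) _ _
    => [v|] /=; ring.
apply: hasE_eq (hasE_sum _ (fun i => hasE_sum _ (H i))) _ erefl => v.
by rewrite /sqdist big_distrlr.
Qed.

End sqdist_moments.

(** Integrated form of the two Taylor bounds: second order from above, third order from below with
    [f] dominating the cubic term. *)
Lemma hasE_expRN d (Omega : measurableType d) (R : realType)
    (Q : probability Omega R) (q f : Omega -> R) (a b e : R) :
  (forall v, 0 <= q v) -> hasE Q q a -> hasE Q (fun v => q v ^+ 2) b ->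
  hasE Q f e -> (forall v, q v ^+ 3 <= f v) ->
  exists A, hasE Q (fun v => expR (- q v)) A /\
    1 - a + b / 2 - e <= A <= 1 - a + b / 2.
Proof.
move=> q0 qa qb fe qf.
have mq := hasE_measurable qa.
have [A hA] : exists A, hasE Q (fun v => expR (- q v)) A.
  apply: (@hasE_bounded _ _ _ _ _ 1).
  - by apply: measurableT_comp => //; exact: measurableT_comp.
  - move=> v; rewrite ger0_norm ?expR_ge0// -expR0 ler_expR oppr_le0//.
exists A; split => //.
have up := hasED (hasEB (hasE_cst Q 1) qa) (hasEZ 2^-1 qb).
apply/andP; split; last first.
  rewrite (mulrC b); apply: (hasE_le hA up) => v.
  by rewrite (mulrC 2^-1) expRN_le_taylor2.
rewrite (mulrC b); apply: (hasE_le (hasEB up fe) hA) => v.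
apply: le_trans (expRN_ge_taylor3 (q0 v)); rewrite (mulrC 2^-1) lerD2l.
by rewrite lerN2.
Qed.

(** * Averaging over the random function *)

Section swap.
Context d (Omega : measurableType d) d' (Omega' : measurableType d')
  (R : realType) (P : probability Omega R) (Q : probability Omega' R).

(** The bound [c], uniform in v, makes f integrable on the product because [Q] has mass 1, so Fubini
    applies. *)
Lemma integral_hasE_swap (f : Omega * Omega' -> R) (g : Omega' -> R) (c e : R) :
  measurable_fun [set: Omega * Omega'] f ->
  (forall v, hasE P (fun w => f (w, v)) (g v)) ->
  (forall v, exists h b, [/\ hasE P h b, forall w, `|f (w, v)| <= h w & b <= c]) ->
  hasE Q g e ->
  (\int[P]_w \int[Q]_v (f (w, v))%:E = e%:E)%E.
Proof.
move=> mf fg fh [_ <-].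
have mfE : measurable_fun [set: Omega * Omega'] (EFin \o f) by exact/measurable_EFinP.
have fi : (P \x Q)%E.-integrable [set: Omega * Omega'] (EFin \o f).
  apply/integrable21ltyP => //.
  apply: (@le_lt_trans _ _ (\int[Q]_v c%:E)%E); last first.
    by rewrite integral_cst//= probability_setT mule1 ltry.
  (* Any single v shows this; the default [point] of the space supplies one. *)
  have c0 : 0 <= c.
    have [h [b [hb fh' bc]]] := fh point.
    apply: le_trans bc; apply: (hasE_le (hasE_cst P 0) hb) => w.
    exact: le_trans (fh' w).
  apply: ge0_le_integral => //.
  - by move=> v _; exact: integral_ge0.
  - have := @measurable_fun_fubini_tonelli_G _ _ _ _ _ P (abse \o (EFin \o f)).
    by apply => [|x]; [exact: measurableT_comp|exact: abse_ge0].
  - move=> v _; have [h [b [hb fh' bc]]] := fh v.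
    apply: (@le_trans _ _ b%:E); last by rewrite lee_fin.
    rewrite -hb.2; apply: ge0_le_integral => //.
    + apply: measurableT_comp => //; apply/measurable_EFinP.
      exact: hasE_measurable (fg v).
    + apply/measurable_EFinP; exact: hasE_measurable hb.
    + by move=> w _; rewrite lee_fin.
have := Fubini fi; rewrite /fubini_F /fubini_G => ->.
by apply: eq_integral => v _; exact: (fg v).2.
Qed.

End swap.

Section skew_process.
Context (R : realType) d (Omega : measurableType d) (P : probability Omega R).
Context d' (E : measurableType d') (U : E * E -> Omega -> R) (D : E -> E -> R).
Variable s : R.
Hypothesis gU : gaussian_process P U.
Hypothesis covU : forall p q, covariance P (U p) (U q) =
  (s ^+ 2 * expR (- 2^-1 * D p.1 q.1 - 2^-1 * D p.2 q.2))%:E.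
Hypothesis D0 : forall x, D x x = 0.
Hypothesis Dsym : forall x y, D x y = D y x.
Let F := skew_diff U.
Hypothesis meanF : forall x y, ('E_P[fun w => F w x y] = 0)%E.

(** Bilinearity over four covariances of U: the two that match x with x give exp (- D y w / 2), the
    two mixed ones give the other exponential. U need not be centered: F has mean 0, so U(a, b) and
    U(b, a) have equal means, which cancel in F. *)
Lemma hasE_skew_diffM (x y w : E) :
  hasE P (fun o => F o x y * F o x w)
    (2 * s ^+ 2 * (expR (- (2^-1 * D y w)) - expR (- (2^-1 * (D x w + D x y))))).
Proof.
have centered a b : fine 'E_P[U (a, b)] = fine 'E_P[U (b, a)].
  have hF := hasEB (gaussian_process_mean gU (a, b)) (gaussian_process_mean gU (b, a)).
  have [_] := hF; have := meanF a b; rewrite expectation.unlock.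
  by rewrite /F /skew_diff => -> [/esym/eqP]; rewrite subr_eq0 => /eqP.
have cov p q := gaussian_process_covariance gU (covU p q).
apply: hasE_eq
  (hasED (hasEB (cov (x, y) (x, w)) (cov (x, y) (w, x)))
         (hasEB (cov (y, x) (w, x)) (cov (y, x) (x, w)))) _ _ => /=.
  by move=> o; rewrite /F /skew_diff (centered y x) (centered w x); ring.
rewrite !D0 (Dsym y x).
rewrite (_ : - 2^-1 * 0 - 2^-1 * D y w = - (2^-1 * D y w)); last by ring.
rewrite (_ : - 2^-1 * D y w - 2^-1 * 0 = - (2^-1 * D y w)); last by ring.
rewrite (_ : - 2^-1 * D x w - 2^-1 * D x y = - (2^-1 * (D x w + D x y))); last by ring.
rewrite (_ : - 2^-1 * D x y - 2^-1 * D x w = - (2^-1 * (D x w + D x y))); last by ring.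
ring.
Qed.

Lemma hasE_skew_diff_sqr (x y : E) :
  hasE P (fun o => F o x y ^+ 2) (2 * s ^+ 2 * (1 - expR (- D x y))).
Proof.
apply: hasE_eq (hasE_skew_diffM x y y) _ _ => //.
have -> : 2^-1 * (D x y + D x y) = D x y by field.
by rewrite D0 mulr0 oppr0 expR0.
Qed.

Context d'' (Omega' : measurableType d'') (Q : probability Omega' R).
Context (pi_X : probability E R) (X Y W : {RV Q >-> E}).
Hypothesis iid : iid3 pi_X X Y W.
Hypothesis mF : measurable_fun [set: Omega * (E * E)] (fun z => F z.1 z.2.1 z.2.2).

Let mFw w : measurable_fun [set: E * E] (fun z => F w z.1 z.2).
Proof.
apply: (measurableT_comp (g := fun z : E * E => (w, z)) mF).
exact: measurable_fun_pair.
Qed.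

Let mFv (A B : {RV Q >-> E}) :
  measurable_fun [set: Omega * Omega'] (fun z => F z.1 (A z.2) (B z.2)).
Proof.
apply: (measurableT_comp (g := fun z : Omega * Omega' => (z.1, (A z.2, B z.2))) mF).
by apply: measurable_fun_pair => //; apply: measurable_fun_pair; exact: measurableT_comp.
Qed.

Let law_XY (A B : set E) : measurable A -> measurable B ->
  Q (X @^-1` A `&` Y @^-1` B) = (pi_X A * pi_X B)%E.
Proof.
move=> mA mB; have := iid3_law iid mA mB measurableT.
by rewrite preimage_setT setIT probability_setT mule1.
Qed.

Let law_XW (A B : set E) : measurable A -> measurable B ->
  Q (X @^-1` A `&` W @^-1` B) = (pi_X A * pi_X B)%E.
Proof.
move=> mA mB; have := iid3_law iid mA measurableT mB.
by rewrite preimage_setT setTI probability_setT mul1e.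
Qed.

Let mean_XY w : fine 'E_Q[fun v => F w (X v) (Y v)] = 0.
Proof.
apply: (@fine_expectation_skew _ _ _ Q _ _ pi_X X Y (fun z => F w z.1 z.2)) => //.
by move=> x y; rewrite /F /skew_diff opprB.
Qed.

Let mean_XW w : fine 'E_Q[fun v => F w (X v) (W v)] = 0.
Proof.
apply: (@fine_expectation_skew _ _ _ Q _ _ pi_X X W (fun z => F w z.1 z.2)) => //.
by move=> x y; rewrite /F /skew_diff opprB.
Qed.

Let sqr_le x y : 2 * s ^+ 2 * (1 - expR (- D x y)) <= 2 * s ^+ 2.
Proof.
rewrite -[leRHS]mulr1; apply: ler_wpM2l; first by rewrite mulr_ge0 ?sqr_ge0.
by rewrite lerBlDr lerDl expR_ge0.
Qed.

Lemma edge_varianceE (A : R) :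
  hasE Q (fun v => expR (- D (X v) (Y v))) A ->
  edge_variance P F X Y = (2 * s ^+ 2 * (1 - A))%:E.
Proof.
move=> hA; rewrite /edge_variance.
have h w : 'V_Q[fun v => F w (X v) (Y v)] = (\int[Q]_v (F w (X v) (Y v) ^+ 2)%:E)%E.
  by rewrite /variance covariance.unlock mean_XY expectation.unlock;
    apply: eq_integral => v _; rewrite /= !fctE/= subr0 -expr2.
under eq_integral do rewrite h.
apply: (integral_hasE_swap (f := fun z => F z.1 (X z.2) (Y z.2) ^+ 2)
  (g := fun v => 2 * s ^+ 2 * (1 - expR (- D (X v) (Y v)))) (c := 2 * s ^+ 2)).
- exact: measurable_funX.
- by move=> v; exact: (hasE_skew_diff_sqr (X v) (Y v)).
- move=> v; exists (fun w => F w (X v) (Y v) ^+ 2).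
  exists (2 * s ^+ 2 * (1 - expR (- D (X v) (Y v)))); split.
  + exact: (hasE_skew_diff_sqr (X v) (Y v)).
  + by move=> w; rewrite ger0_norm ?sqr_ge0.
  + exact: sqr_le.
- by apply: hasEZ; apply: hasEB => //; exact: hasE_cst.
Qed.

Lemma shared_endpoint_covarianceE (B C : R) :
  hasE Q (fun v => expR (- (2^-1 * D (Y v) (W v)))) B ->
  hasE Q (fun v => expR (- (2^-1 * (D (X v) (W v) + D (X v) (Y v))))) C ->
  shared_endpoint_covariance P F X Y W = (2 * s ^+ 2 * (B - C))%:E.
Proof.
move=> hB hC; rewrite /shared_endpoint_covariance.
have h w : covariance Q (fun v => F w (X v) (Y v)) (fun v => F w (X v) (W v)) =
    (\int[Q]_v (F w (X v) (Y v) * F w (X v) (W v))%:E)%E.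
  by rewrite covariance.unlock mean_XY mean_XW expectation.unlock;
    apply: eq_integral => v _; rewrite /= !fctE/= !subr0.
under eq_integral do rewrite h.
apply: (integral_hasE_swap (f := fun z => F z.1 (X z.2) (Y z.2) * F z.1 (X z.2) (W z.2))
  (g := fun v => 2 * s ^+ 2 * (expR (- (2^-1 * D (Y v) (W v))) -
     expR (- (2^-1 * (D (X v) (W v) + D (X v) (Y v))))))
  (c := 2 * s ^+ 2 + 2 * s ^+ 2)).
- exact: measurable_funM.
- by move=> v; exact: (hasE_skew_diffM (X v) (Y v) (W v)).
(* The product is dominated by the sum of the two squares, whose second moments are at most 2 s^2
   each, whatever the endpoints. *)
- move=> v; exists (fun w => F w (X v) (Y v) ^+ 2 + F w (X v) (W v) ^+ 2).
  exists (2 * s ^+ 2 * (1 - expR (- D (X v) (Y v))) +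
          2 * s ^+ 2 * (1 - expR (- D (X v) (W v)))); split.
  + by apply: hasED; exact: hasE_skew_diff_sqr.
  + by move=> w; exact: normrM_le_sqrD.
  + by apply: lerD; exact: sqr_le.
- by apply: hasEZ; exact: hasEB.
Qed.

End skew_process.

(** * The expansion of the correlation *)

(** [al] and [be] are the errors in 1 - A = 2 t - 2 t^2 - 4 p + al and B - C = t - 3/2 t^2 - 3/2 p +
    be. Over the denominator 1 - A, the terms of order t and t^2 cancel, and what remains is O(t^3)
    / t. *)
Lemma correlation_expansion (R : realFieldType) (K t p A B C eA eB eC : R) :
  0 < t -> t <= 6^-1 -> 0 <= p -> p <= t ^+ 2 -> 0 <= K ->
  1 - 2 * t + (4 * t ^+ 2 + 8 * p) / 2 - eA <= A <= 1 - 2 * t + (4 * t ^+ 2 + 8 * p) / 2 ->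
  1 - t + (t ^+ 2 + 2 * p) / 2 - eB <= B <= 1 - t + (t ^+ 2 + 2 * p) / 2 ->
  1 - 2 * t + (4 * t ^+ 2 + 5 * p) / 2 - eC <= C <= 1 - 2 * t + (4 * t ^+ 2 + 5 * p) / 2 ->
  eA <= K * t ^+ 3 -> eB <= K * t ^+ 3 -> eC <= K * t ^+ 3 ->
  `|2^-1 - (1 - A)^-1 * (B - C) - 4^-1 * (t - p / t)| <= (2 * K + 2) * t ^+ 2.
Proof.
move=> t0 t6 p0 pt K0 /andP[A1 A2] /andP[B1 B2] /andP[C1 C2] hA hB hC.
have tt : t ^+ 2 <= t / 6 by rewrite expr2 ler_pM2l.
(* Since p <= t^2, 1 - A is at least 2 t - 6 t^2; this is where t <= 1/6 is used. *)
have Dt : t <= 1 - A by lra.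
have D0 : 0 < 1 - A by exact: lt_le_trans Dt.
set x := p / t.
have px : p = x * t by rewrite /x divfK// gt_eqF.
have x0 : 0 <= x by rewrite divr_ge0// ltW.
have xt : x <= t by rewrite ler_pdivrMr// -expr2.
pose al := 1 - A - (2 * t - 2 * t ^+ 2 - 4 * p).
pose be := B - C - (t - 3 / 2 * t ^+ 2 - 3 / 2 * p).
have al0 : 0 <= al by rewrite /al; lra.
have alK : al <= K * t ^+ 3 by rewrite /al; lra.
have be1 : - (K * t ^+ 3) <= be by rewrite /be; lra.
have be2 : be <= K * t ^+ 3 by rewrite /be; lra.
(* The leading part (1 - A) / 2 - (B - C) is t (t - x) / 2, which 2 t (t - x) / 4 removes
   exactly. *)
have -> : 2^-1 - (1 - A)^-1 * (B - C) - 4^-1 * (t - x) =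
    (al / 2 - be + (2 * t ^+ 2 + 4 * p - al) * (t - x) / 4) / (1 - A).
  apply: (canRL (mulfK (lt0r_neq0 D0))).
  rewrite !mulrBl mulrAC mulVf ?lt0r_neq0// mul1r.
  by rewrite /al /be px; field.
rewrite normrM normfV (gtr0_norm D0) ler_pdivrMr//.
apply: (@le_trans _ _ ((2 * K + 2) * t ^+ 2 * t)); last first.
  by rewrite ler_wpM2l// mulr_ge0 ?sqr_ge0 ?addr_ge0 ?mulr_ge0.
have t3 : 0 <= t ^+ 3 by rewrite exprn_ge0// ltW.
have Kt3 : 0 <= K * t ^+ 3 by exact: mulr_ge0.
have tx0 : 0 <= t - x by lra.
have u1 : (2 * t ^+ 2 + 4 * p) * (t - x) <= 6 * t ^+ 3.
  rewrite (exprS t 2) [X in _ <= X]mulrCA [X in _ <= X]mulrC.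
  by apply: ler_pM => //; [have := sqr_ge0 t; lra|lra|lra].
have u0 : 0 <= (2 * t ^+ 2 + 4 * p) * (t - x).
  by apply: mulr_ge0 => //; have := sqr_ge0 t; lra.
have v1 : al * (t - x) <= K * t ^+ 3 * 1 by apply: ler_pM => //; lra.
have v0 : 0 <= al * (t - x) by exact: mulr_ge0.
rewrite (_ : _ * t ^+ 2 * t = 2 * (K * t ^+ 3) + 2 * t ^+ 3); last by ring.
rewrite [(_ - al) * _]mulrBl ler_norml; apply/andP; split; lra.
Qed.

Section expansion.
Context d (Omega : measurableType d) (R : realType) (Q : probability Omega R).
Context d' (E : measurableType d') (mu : probability E R).
Context (T : nat) (z : 'I_T -> E -> R) (S : 'M[R]_T).
Context (X Y W : {RV Q >-> E}).
Hypothesis gz : gaussian_moments mu z S.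
Hypothesis iid : iid3 mu X Y W.

Let t := \tr S.
Let p := \sum_i \sum_j S i j ^+ 2.
Let K : R := 1920 * T%:R ^+ 3.
Let D := sqdist z.

(** The second moments are 4 t^2 + 8 p for q, a quarter of it for q / 2, and for the half sum of two
    distances 4 t^2 + 5 p, with 5 = (8 + 8 + 2 * 2) / 4. *)
Lemma laplace_expansion : exists A B C eA eB eC,
  [/\ hasE Q (fun v => expR (- D (X v) (Y v))) A,
      hasE Q (fun v => expR (- (2^-1 * D (Y v) (W v)))) B,
      hasE Q (fun v => expR (- (2^-1 * (D (X v) (W v) + D (X v) (Y v))))) C &
  [/\ 1 - 2 * t + (4 * t ^+ 2 + 8 * p) / 2 - eA <= A <=
        1 - 2 * t + (4 * t ^+ 2 + 8 * p) / 2,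
      1 - t + (t ^+ 2 + 2 * p) / 2 - eB <= B <= 1 - t + (t ^+ 2 + 2 * p) / 2,
      1 - 2 * t + (4 * t ^+ 2 + 5 * p) / 2 - eC <= C <=
        1 - 2 * t + (4 * t ^+ 2 + 5 * p) / 2 &
      [/\ eA <= K * t ^+ 3, eB <= K * t ^+ 3 & eC <= K * t ^+ 3]]].
Proof.
have XY f g a b : hasE mu f a -> hasE mu g b ->
    hasE Q (fun v => f (X v) * g (Y v)) (a * b).
  move=> fa gb; apply: hasE_eq (hasE_iid3 iid fa gb (hasE_cst mu 1)) _ _ => [v|].
    by rewrite mulr1.
  by rewrite mulr1.
have XW f g a b : hasE mu f a -> hasE mu g b ->
    hasE Q (fun v => f (X v) * g (W v)) (a * b).
  move=> fa gb; apply: hasE_eq (hasE_iid3 iid fa (hasE_cst mu 1) gb) _ _ => [v|].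
    by rewrite mul1r.
  by rewrite mul1r.
have YW f g a b : hasE mu f a -> hasE mu g b ->
    hasE Q (fun v => f (Y v) * g (W v)) (a * b).
  move=> fa gb; apply: hasE_eq (hasE_iid3 iid (hasE_cst mu 1) fa gb) _ _ => [v|].
    by rewrite mul1r.
  by rewrite mul1r.
have t0 : 0 <= t by apply: sumr_ge0 => i _; exact: (gaussian_moments_diag_ge0 gz).
have kt : 0 <= 960 * T%:R ^+ 3 * t ^+ 3.
  apply: mulr_ge0; last exact: exprn_ge0.
  by apply: mulr_ge0; [exact: ler0n|rewrite exprn_ge0].
(* The factor 2 allows for C, whose remainder adds the bounds of two distances. *)
have KE : K * t ^+ 3 = 2 * (960 * T%:R ^+ 3 * t ^+ 3) by rewrite /K; ring.
have [fXY [eXY [hXY cXY bXY]]] := sqdist_cube_bound gz XY.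
have [fXW [eXW [hXW cXW bXW]]] := sqdist_cube_bound gz XW.
have [fYW [eYW [hYW cYW bYW]]] := sqdist_cube_bound gz YW.
have [A [hA bA]] := hasE_expRN (fun v => sqdist_ge0 z (X v) (Y v))
  (hasE_sqdist gz XY) (hasE_sqdist_sqr gz XY) hXY cXY.
have YW2 : hasE Q (fun v => (2^-1 * D (Y v) (W v)) ^+ 2) (t ^+ 2 + 2 * p).
  apply: hasE_eq (hasEZ (4^-1) (hasE_sqdist_sqr gz YW)) _ _ => [v|].
    by rewrite -/D; field.
  by rewrite -/t -/p; field.
have YW1 : hasE Q (fun v => 2^-1 * D (Y v) (W v)) t.
  by apply: hasE_eq (hasEZ (2^-1) (hasE_sqdist gz YW)) _ _ => //; rewrite -/t; field.
have D0 x y : 0 <= D x y by exact: sqdist_ge0.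
have [B [hB bB]] : exists B, hasE Q (fun v => expR (- (2^-1 * D (Y v) (W v)))) B /\
    1 - t + (t ^+ 2 + 2 * p) / 2 - eYW <= B <= 1 - t + (t ^+ 2 + 2 * p) / 2.
  apply: (hasE_expRN _ YW1 YW2 hYW) => v; first exact: mulr_ge0.
  apply: le_trans (cYW v); rewrite -/D exprMn.
  by have := exprn_ge0 3 (D0 (Y v) (W v)); lra.
have C1 : hasE Q (fun v => 2^-1 * (D (X v) (W v) + D (X v) (Y v))) (2 * t).
  apply: hasE_eq (hasEZ (2^-1) (hasED (hasE_sqdist gz XW) (hasE_sqdist gz XY))) _ _ => //.
  by rewrite -/t; field.
have XWY : hasE Q (fun v => D (X v) (W v) * D (X v) (Y v)) (4 * t ^+ 2 + 2 * p).
  by apply: (hasE_sqdist_shared gz) => f g h a b c; exact: hasE_iid3.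
have C2 : hasE Q (fun v => (2^-1 * (D (X v) (W v) + D (X v) (Y v))) ^+ 2)
    (4 * t ^+ 2 + 5 * p).
  apply: hasE_eq (hasEZ (4^-1) (hasED
    (hasED (hasE_sqdist_sqr gz XW) (hasE_sqdist_sqr gz XY))
    (hasEZ 2 XWY))) _ _ => [v|].
    by rewrite -/D; field.
  by rewrite -/t -/p; field.
have cube (a b : R) : 0 <= a -> 0 <= b -> (2^-1 * (a + b)) ^+ 3 <= a ^+ 3 + b ^+ 3.
  move=> a0 b0.
  have : 0 <= (a + b) * (a - b) ^+ 2.
    by apply: mulr_ge0; [exact: addr_ge0|exact: sqr_ge0].
  have := exprn_ge0 3 a0; have := exprn_ge0 3 b0.
  have -> : (2^-1 * (a + b)) ^+ 3 =
    2^-1 * (a ^+ 3 + b ^+ 3) - 8^-1 * 3 * ((a + b) * (a - b) ^+ 2) by field.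
  lra.
have [C [hC bC]] : exists C,
    hasE Q (fun v => expR (- (2^-1 * (D (X v) (W v) + D (X v) (Y v))))) C /\
    1 - 2 * t + (4 * t ^+ 2 + 5 * p) / 2 - (eXW + eXY) <= C <=
      1 - 2 * t + (4 * t ^+ 2 + 5 * p) / 2.
  apply: (hasE_expRN _ C1 C2 (hasED hXW hXY)) => v.
    by apply: mulr_ge0 => //; exact: addr_ge0.
  apply: (@le_trans _ _ (D (X v) (W v) ^+ 3 + D (X v) (Y v) ^+ 3)).
    exact: cube.
  by apply: lerD; [exact: cXW|exact: cXY].
exists A, B, C, eXY, eYW, (eXW + eXY).
split; [exact: hA|exact: hB|exact: hC|split; [exact: bA|exact: bB|exact: bC|]].
rewrite KE -/t; move: bXY bXW bYW kt; rewrite -/t.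
by move: (960 * _ * _) => k b1 b2 b3 k0; split; lra.
Qed.

End expansion.

Lemma se_kernel_sqdist (R : realType) (T : nat) (sigma_u : R)
    (Sigma_u L : 'M[R]_T) (m : 'cV[R]_T) (p q : T.-tuple R * T.-tuple R) :
  invmx Sigma_u = L^T *m L ->
  let D := sqdist (fun i (x : T.-tuple R) => (L *m (vec x - m)) i ord0) in
  se_kernel sigma_u Sigma_u p q =
  sigma_u ^+ 2 * expR (- 2^-1 * D p.1 q.1 - 2^-1 * D p.2 q.2).
Proof.
move=> SL D; rewrite /se_kernel /=.
have H x y : ((vec x - vec y)^T *m invmx Sigma_u *m (vec x - vec y)) ord0 ord0 = D x y.
  rewrite SL mulmxA -mulmxA -trmx_mul mxE; apply: eq_bigr => i _.
  have -> : vec x - vec y = (vec x - m) - (vec y - m) by rewrite opprB addrA subrK.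
  by rewrite mulmxBr !mxE expr2.
by rewrite !H.
Qed.

Lemma sum_sqr_le_sqr_sum (R : realFieldType) (T : nat) (a : 'I_T -> R) :
  (forall i, 0 <= a i) -> \sum_i a i ^+ 2 <= (\sum_i a i) ^+ 2.
Proof.
move=> a0; rewrite expr2 mulr_suml; apply: ler_sum => i _.
by rewrite expr2 ler_wpM2l// (bigD1 i)//= lerDl sumr_ge0.
Qed.

(** With s the sum and q the sum of squares, dis = q / s - s / T, and the s / T completes (T - 1) s
    / T to s. The two forms of the expansion therefore agree exactly. *)
Lemma var_av_dis (R : realType) (T : nat) (a : 'rV[R]_T) :
  (0 < T)%N -> \sum_j a ord0 j != 0 ->
  (T%:R - 1) * av a - dis a =
  \sum_j a ord0 j - (\sum_j a ord0 j ^+ 2) / \sum_j a ord0 j.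
Proof.
move=> T0 s0; rewrite /dis /var /av.
have -> : \sum_j (sq a) ord0 j = \sum_j a ord0 j ^+ 2.
  by apply: eq_bigr => j _; rewrite mxE.
have T0' : T%:R != 0 :> R by rewrite pnatr_eq0 -lt0n.
move: (\sum_j a ord0 j) (\sum_j _) (T%:R) s0 T0' => s q n s0 n0.
by field; rewrite s0 n0.
Qed.

(* Since rho is a function of r, the O(||r||^4) as r -> 0 is one constant C,
   valid for all models whose parameter vector r is near 0. *)
Theorem mainTheorem5 (R : realType) (T : nat) (T_ge1 : (1 <= T)%N) :
  exists C : R, \forall r \near (0 : 'rV[R]_T),
  forall (Sigma_u Sigma_x : 'M[R]_T) (sigma_u : R)
    (d : measure_display) (Omega : measurableType d) (P : probability Omega R)
    (U : T.-tuple R * T.-tuple R -> Omega -> R)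
    (pi_X : probability (T.-tuple R) R)
    (d' : measure_display) (Omega' : measurableType d')
    (Q : probability Omega' R) (X Y W : {RV Q >-> T.-tuple R})
    (Rmx : 'M[R]_T) (lam : 'I_T -> R),
  let F := skew_diff U in
  posdefmx Sigma_u -> posdefmx Sigma_x -> 0 < sigma_u ->
  gaussian_process P U ->
  (forall p q, covariance P (U p) (U q) = (se_kernel sigma_u Sigma_u p q)%:E) ->
  (forall x y, 'E_P[fun w => F w x y] = 0)%E ->
  measurable_fun [set: Omega * (T.-tuple R * T.-tuple R)]
    (fun z => F z.1 z.2.1 z.2.2) ->
  multivariate_gaussian pi_X Sigma_x ->
  iid3 pi_X X Y W ->
  Rmx ~_{in unitmx} (invmx Sigma_u *m Sigma_x) ->
  eigenvalues_of Rmx lam ->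
  r = \row_(j < T) Num.sqrt (lam j) ->
  let rho := shared_endpoint_correlation P F X Y W in
  `|2^-1 - rho - 4^-1 * (\tr Rmx - \tr (Rmx *m Rmx) / \tr Rmx)|
     <= C * norm2 r ^+ 4 /\
  `|2^-1 - rho - 4^-1 * ((T%:R - 1) * av (sq r) - dis (sq r))|
     <= C * norm2 r ^+ 4.
Proof.
exists (2 * (1920 * T%:R ^+ 3) + 2).
(* In the sup-norm ball of radius eps <= 1, each lam j = r_j^2 is at most eps, so t <= T eps = 1/6,
   as [correlation_expansion] requires. *)
pose eps : R := (6 * T%:R)^-1.
have T0 : 0 < T%:R :> R by rewrite ltr0n.
have T1 : 1 <= T%:R :> R by rewrite ler1n.
have eps0 : 0 < eps by rewrite invr_gt0 mulr_gt0.
have eps1 : eps <= 1.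
  by rewrite invf_le1 ?mulr_gt0//; lra.
apply/nbhs_ballP; exists eps => //= r rball.
move=> Sigma_u Sigma_x sigma_u d Omega P U pi_X d' Omega' Q X Y W Rmx lam.
move=> posu posx sigma0 gU covU meanF mF gX iid [B uB simB] lamR rE.
set rho := shared_endpoint_correlation P (skew_diff U) X Y W.
have simR : B *m Rmx = invmx Sigma_u *m Sigma_x *m B by apply/(simmxP uB).
(* [Num.sqrt] is 0 on negative numbers; positivity guarantees that r_j squares back to lam j and
   that the trace is nonzero. *)
have lam0 := eigenvalues_of_similar_posdef_gt0 posu posx uB simR lamR.
have trR := eigenvalues_of_mxtrace lamR.
have trR2 := eigenvalues_of_mxtrace (eigenvalues_of_sqr lamR).
have rlam j : r ord0 j ^+ 2 = lam j by rewrite rE mxE sqr_sqrtr// ltW.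
have [L SL] := posdefmx_cholesky (posdefmx_inv posu).
have [m gz] := multivariate_gaussian_moments L gX posx.1.
move: gz; set z := (fun i x => _) => gz.
set S := L *m Sigma_x *m L^T in gz.
(* Cyclicity of the trace: S = (L Sigma_x) L^T, while Sigma_u^-1 Sigma_x = L^T (L Sigma_x); the same
   argument handles the squares. *)
have trS : \tr S = \tr Rmx.
  by rewrite (similar_mxtrace uB simR) SL mxtrace_mulC mulmxA.
have trS2 : \sum_i \sum_j S i j ^+ 2 = \tr (Rmx *m Rmx).
  have -> : \sum_i \sum_j S i j ^+ 2 = \tr (S *m S^T).
    apply: eq_bigr => i _; rewrite [RHS]mxE; apply: eq_bigr => j _.
    by rewrite [S^T _ _]mxE expr2.
  have simR2 : B *m (Rmx *m Rmx) =
      (invmx Sigma_u *m Sigma_x) *m (invmx Sigma_u *m Sigma_x) *m B.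
    by rewrite mulmxA simR -(mulmxA _ B Rmx) simR !mulmxA.
  have NE : invmx Sigma_u *m Sigma_x = L^T *m (L *m Sigma_x) by rewrite SL mulmxA.
  rewrite (similar_mxtrace uB simR2) gz.1 NE /S; move: (L *m Sigma_x) => N.
  by rewrite -(mulmxA N) mxtrace_mulC !mulmxA.
pose t := \sum_j lam j; pose q := \sum_j lam j ^+ 2.
have t0 : 0 < t.
  rewrite /t (bigD1 (Ordinal T_ge1))//= ltr_pwDl// sumr_ge0// => j _.
  exact: ltW.
have tnorm : norm2 r ^+ 4 = t ^+ 2.
  rewrite (exprM _ 2 2) /norm2 sqr_sqrtr; last by apply: sumr_ge0 => j _; exact: sqr_ge0.
  by congr (_ ^+ 2); apply: eq_bigr => j _.
have t6 : t <= 6^-1.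
  have le j : lam j <= eps.
    have [_ /(_ ord0 j)] := rball; rewrite /ball/= mxE sub0r normrN => rj.
    rewrite -rlam -real_normK ?num_real// expr2 -[leRHS]mulr1.
    by apply: ler_pM => //; [exact: ltW|apply: le_trans eps1; exact: ltW].
  have -> : 6^-1 = \sum_(j < T) eps.
    by rewrite sumr_const card_ord -[RHS]mulr_natr /eps invfM divfK// gt_eqF.
  by apply: ler_sum => j _.
have q0 : 0 <= q by apply: sumr_ge0 => j _; exact: sqr_ge0.
have qt : q <= t ^+ 2 by apply: sum_sqr_le_sqr_sum => j; exact: ltW.
have trR' : \tr Rmx = t := trR.
have trR2' : \tr (Rmx *m Rmx) = q := trR2.
have [A [BB [CC [eA [eB [eC [hA hB hC [bA bB bC [kA kB kC]]]]]]]]] :=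
  laplace_expansion gz iid.
rewrite trS trS2 trR' trR2' in bA bB bC kA kB kC.
have K0 : 0 <= 1920 * T%:R ^+ 3 :> R.
  by apply: mulr_ge0; [exact: ler0n|apply: exprn_ge0; exact: ltW].
have main := correlation_expansion t0 t6 q0 qt K0 bA bB bC kA kB kC.
have covU' p p' : covariance P (U p) (U p') =
    (sigma_u ^+ 2 * expR (- 2^-1 * sqdist z p.1 p'.1 - 2^-1 * sqdist z p.2 p'.2))%:E.
  by rewrite covU (se_kernel_sqdist _ m _ _ SL).
have D0 x : sqdist z x x = 0.
  by apply: big1 => i _; rewrite subrr expr0n.
have Dsym x y : sqdist z x y = sqdist z y x.
  by apply: eq_bigr => i _; rewrite -sqrrN opprB.
have ev := edge_varianceE gU covU' D0 Dsym meanF iid mF hA.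
have cv := shared_endpoint_covarianceE gU covU' D0 Dsym meanF iid mF hB hC.
have rhoE : rho = (1 - A)^-1 * (BB - CC).
  rewrite /rho /shared_endpoint_correlation ev cv /=.
  have s0 : 2 * sigma_u ^+ 2 != 0 by rewrite gt_eqF// mulr_gt0// exprn_gt0.
  by rewrite invfM mulrACA mulVf// mul1r.
have sqr0 : \sum_j (sq r) ord0 j = t.
  by apply: eq_bigr => j _; rewrite mxE rlam.
have sqr2 : \sum_j (sq r) ord0 j ^+ 2 = q.
  by apply: eq_bigr => j _; rewrite mxE rlam.
rewrite var_av_dis ?sqr0 ?gt_eqF// sqr2 trR' trR2' rhoE tnorm; split; exact: main.
Qed.
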